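(* Suppose the relay feedback system has a second order linear time-invariant plant whose transfer function (a) is proper, (b) is stable, (c) is nonminimum phase, and (d) has a positive DC gain; that is, the transfer function is $\dfrac{-\kappa s+\gamma}{(s-p_1)(s-p_2)}$ with real $\kappa>0$, $\gamma>0$, and with poles $p_1,p_2$ that have strictly negative real parts and are either both real (possibly equal) or a complex conjugate pair. Then there is a symmetric, unimodal limit cycle to which every trajectory of the relay feedback system converges asymptotically (with ''every trajectory converges'' read in the weak sense described in the context).
   Context: The plant is realized in state space by $\dot x=Ax+Bu$, $y=Cx$, $x=(x_1,x_2)^T\in\mathbb{R}^2$, with $$A=\begin{bmatrix}0&-p_1p_2\\1&p_1+p_2\end{bmatrix},\quad B=\begin{bmatrix}\gamma\\-\kappa\end{bmatrix},\quad C=\begin{bmatrix}0&1\end{bmatrix}.$$ The relay feedback system is the negative feedback loop $u=-\operatorname{sign}(y)$ with an ideal on-off relay (no hysteresis, no time delay), so that $\dot x=Ax-B\,\operatorname{sign}(Cx)$. The switching line is $\{x\in\mathbb{R}^2: x_2=0\}$. Trajectories are solutions in the sense of Filippov: they satisfy, for almost every time, the differential inclusion $\dot x\in\{Ax-B\}$ if $Cx>0$, $\dot x\in\{Ax+B\}$ if $Cx<0$, and $\dot x\in\{Ax+B\lambda:\lambda\in[-1,1]\}$ if $Cx=0$. Solutions need not be unique: through each point $(x_1,0)$ with $x_1\in[-\kappa,\kappa]$ there are infinitely many, including ones that slide along the switching line to the origin and ones that slide for a while and then leave the line. The assertion that every trajectory converges to the limit cycle is understood in the weak sense of global attractivity: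 from every point of the state space there is at least one solution that converges to the limit cycle. A limit cycle is (the orbit of) a non-constant periodic trajectory. It is symmetric if its locus in $\mathbb{R}^2$ is symmetric with respect to the origin. It is unimodal if the output of the relay changes sign exactly two times per period. A trajectory converges asymptotically to a limit cycle if the distance from $x(t)$ to the locus of the limit cycle tends to $0$ as $t\to\infty$. *)

(* Defs.v *)
From HB Require Import structures.
From mathcomp Require Import all_boot all_order all_algebra.
From mathcomp Require Import all_classical all_reals all_analysis.
From mathcomp Require Import complex ring.

Set Implicit Arguments.
Unset Strict Implicit.
Unset Printing Implicit Defensive.

Import Order.TTheory GRing.Theory Num.Theory.
Import numFieldNormedType.Exports.

Local Open Scope classical_set_scope.
Local Open Scope ring_scope.

Lemma companion_transfer (F : fieldType) (k g p1 p2 s : F) (A : 'M[F]_2) (B : 'cV[F]_2)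
   (C : 'rV[F]_2) :
  (forall i j, A i j = if i == 0 then (if j == 0 then 0 else - (p1 * p2))
    else (if j == 0 then 1 else p1 + p2)) ->
  (forall i j, B i j = if i == 0 then g else - k) ->
  (forall i j, C i j = if j == 0 then 0 else 1) ->
  s != p1 -> s != p2 ->
  (C *m invmx (s%:M - A) *m B) 0 0 = (- k * s + g) / ((s - p1) * (s - p2)).
Proof.
move=> HA HB HC; rewrite -subr_eq0 => sp1; rewrite -subr_eq0 => sp2.
pose N : 'M[F]_2 := \matrix_(i < 2, j < 2)
  ((if i == 0 then (if j == 0 then s - (p1 + p2) else - (p1 * p2))
    else (if j == 0 then 1 else s)) / ((s - p1) * (s - p2))).
have MN : (s%:M - A) *m N = 1%:M.
  apply/matrixP => i j; rewrite !mxE !big_ord_recl big_ord0 !mxE !HA /=.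
  case: i => [[|[|i]] Hi] //; case: j => [[|[|j]] Hj] //=;
    rewrite ?mulr1n ?mulr0n; field; by rewrite sp1 sp2.
have [Mu _] := mulmx1_unit MN.
have -> : invmx (s%:M - A) = N by rewrite -[LHS]mulmx1 -MN mulKmx.
rewrite !mxE !big_ord_recl big_ord0 !mxE !big_ord_recl !big_ord0 !mxE !HB !HC /=.
by field; rewrite sp1 sp2.
Qed.

Section plant.
Context {R : realType}.

(* The poles are complex; p1 * p2 and p1 + p2 are real when p1 and p2 are both
   real or conjugate to each other, so taking real parts loses nothing. *)
Definition plantA (p1 p2 : R[i]) : 'M[R]_2 :=
  \matrix_(i < 2, j < 2)
    if i == 0 then (if j == 0 then 0 else - complex.Re (p1 * p2))
    else (if j == 0 then 1 else complex.Re (p1 + p2)).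

Definition plantB (kappa gamma : R) : 'cV[R]_2 :=
  \col_(i < 2) if i == 0 then gamma else - kappa.

Definition plantC : 'rV[R]_2 := \row_(j < 2) if j == 0 then 0 else 1.

Definition real_or_conjugate (p1 p2 : R[i]) : Prop :=
  (complex.Im p1 = 0 /\ complex.Im p2 = 0) \/ p2 = conjc p1.

Definition transfer_function (A : 'M[R]_2) (B : 'cV[R]_2) (C : 'rV[R]_2)
    (s : R[i]) : R[i] :=
  let cplx m n (M : 'M[R]_(m, n)) := map_mx (real_complex R) M in
  (cplx _ _ C *m invmx (s%:M - cplx _ _ A) *m cplx _ _ B) 0 0.

Lemma plant_transfer_function (kappa gamma : R) (p1 p2 s : R[i]) :
  real_or_conjugate p1 p2 -> s != p1 -> s != p2 ->
  transfer_function (plantA p1 p2) (plantB kappa gamma) plantC s =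
  (- (kappa%:C)%C * s + (gamma%:C)%C) / ((s - p1) * (s - p2)).
Proof.
move=> p12 sp1 sp2.
have reM : ((complex.Re (p1 * p2))%:C)%C = p1 * p2.
  case: p12 => [|->]; case: p1 p2 {sp1 sp2} => a b [c d].
    by case=> /= -> ->; congr Complex; rewrite mulr0 mul0r addr0.
  by congr Complex; rewrite mulrN mulrC addNr.
have reD : ((complex.Re (p1 + p2))%:C)%C = p1 + p2.
  case: p12 => [|->]; case: p1 p2 {sp1 sp2 reM} => a b [c d].
    by case=> /= -> ->; congr Complex; rewrite addr0.
  by congr Complex; rewrite subrr.
rewrite /transfer_function.
apply: (@companion_transfer (R[i] : fieldType) (kappa%:C)%C (gamma%:C)%C p1 p2 s); last 2 first.
- exact: sp1.
- exact: sp2.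
- move=> i j; rewrite [LHS]mxE [plantA _ _ _ _]mxE.
  case: ifP => _; case: ifP => _.
  + exact: rmorph0.
  + by rewrite -reM; exact: rmorphN.
  + exact: rmorph1.
  + exact: reD.
- move=> i j; rewrite [LHS]mxE [plantB _ _ _ _]mxE.
  by case: ifP => _ //; exact: rmorphN.
- move=> i j; rewrite [LHS]mxE [plantC _ _]mxE.
  by case: ifP => _; [exact: rmorph0|exact: rmorph1].
Qed.

End plant.

Section relay_feedback.
Context {R : realType}.
Implicit Types (A : 'M[R]_2) (B : 'cV[R]_2) (C : 'rV[R]_2) (x : R -> 'cV[R]_2).

Definition filippov A B C (z : 'cV[R]_2) : set 'cV[R]_2 :=
  let y := (C *m z) 0 0 in
  if 0 < y then [set A *m z - B]
  else if y < 0 then [set A *m z + B]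
  else [set A *m z + l *: B | l in `[-1, 1]].

Definition absolutely_continuous_on (a b : R) x : Prop :=
  forall e : R, 0 < e -> exists2 d : R, 0 < d &
    forall (n : nat) (l r : 'I_n -> R),
      (forall i, [/\ a <= l i, l i <= r i & r i <= b]) ->
      trivIset setT (fun i => `](l i), (r i)[%classic) ->
      \sum_(i < n) (r i - l i) < d ->
      \sum_(i < n) `|x (r i) - x (l i)| < e.

(* Trajectories live on [0, +oo[; the values at negative times are junk. *)
Definition trajectory A B C x : Prop :=
  (forall b : R, 0 < b -> absolutely_continuous_on 0 b x) /\
  {ae (@lebesgue_measure R), forall t : R, 0 <= t ->
     exists2 v, is_derive t (1 : R) x v & filippov A B C (x t) v}.

Definition relay_output C x (t : R) : R := - Num.sg ((C *m x t) 0 0).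

Definition least_period x (T : R) : Prop :=
  [/\ 0 < T, periodic x T &
      forall T' : R, 0 < T' -> periodic x T' -> T <= T'].

(* The periodic trajectory is extended periodically to negative times, so that
   the limit cycle itself is [range x]. *)
Definition limit_cycle A B C x (T : R) : Prop :=
  [/\ trajectory A B C x, least_period x T & exists s t, x s != x t].

Definition symmetric_locus (G : set 'cV[R]_2) : Prop :=
  forall z, G z -> G (- z).

(* Zeros of u are skipped: what counts is the length of the longest sequence of
   instants of [a, b] along which u alternates between > 0 and < 0. *)
Definition has_sign_changes (u : R -> R) (a b : R) (n : nat) : Prop :=
  exists t : nat -> R,
    [/\ a <= t 0%N, t n <= b &
        forall i, (i < n)%N -> t i < t i.+1 /\ u (t i) * u (t i.+1) < 0].

Definition nb_sign_changes (u : R -> R) (a b : R) (n : nat) : Prop :=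
  has_sign_changes u a b n /\ ~ has_sign_changes u a b n.+1.

(* The period has to start at an instant s where the output is nonzero: if it
   started at a switching instant, that switching would not be counted. *)
Definition unimodal C x (T : R) : Prop :=
  exists s : R, relay_output C x s != 0 /\
    nb_sign_changes (relay_output C x) s (s + T) 2.

(* [edist_inf] is here the distance for the max norm of R^2, which is equivalent
   to the Euclidean one. *)
Definition converges_to x (G : set 'cV[R]_2) : Prop :=
  edist_inf G (x t) @[t --> +oo] --> 0%E.

Definition weakly_globally_attractive A B C (G : set 'cV[R]_2) : Prop :=
  forall x0 : 'cV[R]_2, exists x,
    [/\ trajectory A B C x, x 0 = x0 & converges_to x G].

End relay_feedback.

(* Main.v *)
Require Import Defs.
From mathcomp Require Import all_boot all_order all_algebra.
From mathcomp Require Import all_classical all_reals all_analysis.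
From mathcomp Require Import complex ring lra.

Import Order.TTheory GRing.Theory Num.Theory.
Import numFieldNormedType.Exports.

Local Open Scope classical_set_scope.
Local Open Scope ring_scope.

(** Write [a = - (p1 + p2) > 0] and [b = p1 p2 > 0].  In the upper half-plane the output [w] obeys
    [w'' + a w' + b w = - gamma], and at each switching its derivative jumps by [2 kappa].
    Hence, up to the symmetry [x |-> - x], a trajectory is a chain of arcs above the switching line, and an
    arc of duration [t] starts at speed [gamma * launch t] and ends at speed
    [gamma * landing t], where both functions of [t] increase and are explicit in the fundamental
    solution [phi] of the homogeneous equation.  The durations of successive arcs thus satisfy
    [launch t_(n+1) = landing t_n + 2 kappa / gamma].  The crux is that [launch - landing] is
    strictly increasing (equivalently, the return map of the speed contracts distances), which
    amounts to the inequality [Phi (phi' + exp (- a t)) < phi^2] for the primitive [Phi] of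
    [phi].  As [launch - landing] also ranges over all positive numbers, there is exactly one
    fixed duration, which gives the limit cycle, and every sequence of durations converges to
    it monotonically. *)

(** * Real derivatives and the fundamental solution *)

Section real_derivatives.
Context {R : realType}.
Implicit Types (f g : R -> R) (x t u v : R).

Lemma is_derive_constf x (c : R) : is_derive x (1 : R) (fun _ : R => c) 0.
Proof. exact: is_derive_cst. Qed.

Lemma is_derive_idf x : is_derive x (1 : R) (fun t : R => t) 1.
Proof. exact: is_derive_id. Qed.

Lemma is_derive_addf f g x df dg : is_derive x (1 : R) f df ->
  is_derive x (1 : R) g dg -> is_derive x (1 : R) (fun t => f t + g t) (df + dg).
Proof. exact: is_deriveD. Qed.

Lemma is_derive_oppf f x df : is_derive x (1 : R) f df ->
  is_derive x (1 : R) (fun t => - f t) (- df).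
Proof. exact: is_deriveN. Qed.

Lemma is_derive_mulf f g x df dg : is_derive x (1 : R) f df ->
  is_derive x (1 : R) g dg ->
  is_derive x (1 : R) (fun t => f t * g t) (f x * dg + g x * df).
Proof. exact: is_deriveM. Qed.

Lemma is_derive_compf f g x df dg : is_derive (g x) (1 : R) f df ->
  is_derive x (1 : R) g dg -> is_derive x (1 : R) (fun t => f (g t)) (df * dg).
Proof. exact: is_derive1_comp. Qed.

Lemma is_derive_invf f x df : f x != 0 -> is_derive x (1 : R) f df ->
  is_derive x (1 : R) (fun t => (f t)^-1) (- (f x ^- 2) * df).
Proof. move=> fx0 fdf; have := is_deriveV fx0 => V. exact: V. Qed.

Lemma is_derive1_continuous f x df : is_derive x (1 : R) f df ->
  {for x, continuous f}.
Proof. by move=> [/derivable1_diffP/differentiable_continuous]. Qed.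

Lemma mean_value f (df : R -> R) u v : u < v ->
  (forall t, u <= t <= v -> is_derive t (1 : R) f (df t)) ->
  exists2 c, u < c < v & f v - f u = df c * (v - u).
Proof.
move=> uv fdf.
have [t||c] := @MVT R f df u v uv.
- by rewrite in_itv /= => /andP[ut tv]; apply: fdf; rewrite !ltW.
- apply: derivable_within_continuous => t; rewrite in_itv /= => tuv.
  by have [] := fdf t tuv.
by rewrite in_itv /= => cuv E; exists c.
Qed.

Lemma derive_pos_lt f (df : R -> R) u v : u < v ->
  (forall t, u <= t <= v -> is_derive t (1 : R) f (df t)) ->
  (forall t, u < t < v -> 0 < df t) -> f u < f v.
Proof.
move=> uv fdf df0; have [c cuv E] := mean_value f df u v uv fdf.
by rewrite -subr_gt0 E mulr_gt0 ?subr_gt0 // df0.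
Qed.

Lemma derive_nonneg_le f (df : R -> R) u v : u <= v ->
  (forall t, u <= t <= v -> is_derive t (1 : R) f (df t)) ->
  (forall t, u < t < v -> 0 <= df t) -> f u <= f v.
Proof.
rewrite le_eqVlt => /predU1P[->//|uv] fdf df0.
have [c cuv E] := mean_value f df u v uv fdf.
by rewrite -subr_ge0 E mulr_ge0 ?subr_ge0 ?(ltW uv) // df0.
Qed.

Lemma derive_bound_lipschitz f (df : R -> R) (M u v : R) :
  (forall t, u <= t <= v -> is_derive t (1 : R) f (df t)) ->
  (forall t, u <= t <= v -> `|df t| <= M) -> u <= v ->
  `|f v - f u| <= M * (v - u).
Proof.
move=> fdf dfM; rewrite le_eqVlt => /predU1P[->|uv].
  by rewrite !subrr normr0 mulr0.
have [c /andP[uc cv] ->] := mean_value f df u v uv fdf.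
rewrite normrM [`|v - u|]gtr0_norm ?subr_gt0 // ler_wpM2r ?subr_ge0 ?(ltW uv) //.
by apply: dfM; rewrite !ltW.
Qed.

Lemma continuous_pos f x : {for x, continuous f} -> 0 < f x ->
  exists2 e, 0 < e & forall t, `|t - x| < e -> 0 < f t.
Proof.
move=> fx fx0; have := @cvgr_gt R R (nbhs x) _ f (f x) fx _ fx0.
case=> e /= e0 H; exists e => // t tx; apply: H; rewrite /ball_ /=.
by rewrite distrC.
Qed.

(** The second alternative serves arcs that start on the switching line: near 0 the derivative stays
    positive by continuity, so [f] increases from the value 0. *)
Lemma pos_right_of0 f (df : R -> R) :
  (forall t, is_derive t (1 : R) f (df t)) -> {for 0, continuous df} ->
  0 < f 0 \/ f 0 = 0 /\ 0 < df 0 ->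
  exists2 e, 0 < e & forall t, 0 < t <= e -> 0 < f t.
Proof.
move=> fdf cdf [f0|[f0 df0]].
  have [e e0 H] := continuous_pos f 0 (is_derive1_continuous _ _ _ (fdf 0)) f0.
  exists (e / 2); first by rewrite divr_gt0.
  by move=> t /andP[t0 te]; apply: H; rewrite subr0 gtr0_norm //; lra.
have [e e0 H] := continuous_pos df 0 cdf df0.
exists (e / 2); first by rewrite divr_gt0.
move=> t /andP[t0 te]; rewrite -f0.
refine (derive_pos_lt f df 0 t t0 (fun s _ => fdf s) _) => s /andP[s0 st].
by apply: H; rewrite subr0 gtr0_norm //; lra.
Qed.

(** The zero is the infimum of the positive times at which [f <= 0]. Positivity on []0, e]] keeps it
    away from 0, and continuity excludes both strict signs there. *)
Lemma first_zero f e T : continuous f -> 0 < e ->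
  (forall t, 0 < t <= e -> 0 < f t) -> 0 < T -> f T <= 0 ->
  exists2 z, 0 < z & f z = 0 /\ forall t, 0 < t < z -> 0 < f t.
Proof.
move=> cf e0 fe T0 fT.
pose S := [set t | 0 < t /\ f t <= 0].
have Se t : S t -> e <= t.
  case=> t0 ft; rewrite leNgt; apply/negP => te.
  by have := fe t; rewrite t0 (ltW te) => /(_ isT); rewrite ltNge ft.
have S0 : S !=set0 by exists T.
have Sb : has_lbound S by exists e => t /Se.
have Sinf : has_inf S by [].
have ez : e <= inf S by apply: lb_le_inf.
have z0 : 0 < inf S by apply: lt_le_trans ez.
have pos t : 0 < t < inf S -> 0 < f t.
  move=> /andP[t0 tz]; rewrite ltNge; apply/negP => ft.
  by have := ge_inf Sb (conj t0 ft : S t); rewrite leNgt tz.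
exists (inf S) => //; split => //.
apply/eqP; rewrite eq_le; apply/andP; split; rewrite leNgt; apply/negP => fz.
  have [d d0 H] := continuous_pos f (inf S) (cf _) fz.
  have [s Ss sd] := inf_adherent d0 Sinf.
  have zs : inf S <= s by apply: ge_inf.
  have : 0 < f s by apply: H; rewrite ger0_norm ?subr_ge0 //; lra.
  by rewrite ltNge; case: Ss => _ ->.
have fz' : 0 < - f (inf S) by rewrite oppr_gt0.
have [d d0 H] := continuous_pos (fun t => - f t) (inf S)
  (continuousN (cf _)) fz'.
(* A positive time just left of the infimum, close enough for [f] to be negative by continuity
   although it is positive before the infimum. *)
pose s := inf S - Num.min (d / 2) (inf S / 2).
have m0 : 0 < Num.min (d / 2) (inf S / 2) by rewrite lt_min !divr_gt0.
have m1 : Num.min (d / 2) (inf S / 2) <= d / 2 by rewrite ge_min lexx.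
have m2 : Num.min (d / 2) (inf S / 2) <= inf S / 2 by rewrite ge_min lexx orbT.
have sS : 0 < s < inf S by rewrite /s; apply/andP; split; lra.
have := pos _ sS; have : 0 < - f s.
  by apply: H; rewrite /s addrAC subrr add0r normrN gtr0_norm //; lra.
by lra.
Qed.

End real_derivatives.

Ltac derive_step :=
  match goal with
  | |- is_derive _ _ (fun _ => ?c) _ => notypeclasses refine (is_derive_constf _ _)
  | |- is_derive _ _ (fun t => t) _ => notypeclasses refine (is_derive_idf _)
  | |- is_derive _ _ (fun t => _ + _) _ =>
      notypeclasses refine (is_derive_addf _ _ _ _ _ _ _)
  | |- is_derive _ _ (fun t => - _) _ =>
      notypeclasses refine (is_derive_oppf _ _ _ _)
  | |- is_derive _ _ (fun t => _ * _) _ =>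
      notypeclasses refine (is_derive_mulf _ _ _ _ _ _ _)
  | |- is_derive _ _ (GRing.mul ?c) _ =>
      notypeclasses refine
        (is_derive_mulf _ _ _ _ _ (is_derive_constf _ c) (is_derive_idf _))
  | |- is_derive _ _ (fun t => _^-1) _ =>
      notypeclasses refine (is_derive_invf _ _ _ _ _)
  | |- is_derive _ _ (fun t => expR _) _ =>
      notypeclasses refine (is_derive_compf expR _ _ _ _ (is_derive_expR _) _)
  | |- is_derive _ _ (fun t => cos _) _ =>
      notypeclasses refine (is_derive_compf cos _ _ _ _ (is_derive_cos _) _)
  | |- is_derive _ _ (fun t => sin _) _ =>
      notypeclasses refine (is_derive_compf sin _ _ _ _ (is_derive_sin _) _)
  | H : forall t, is_derive t _ ?f _ |- is_derive _ _ (fun t => ?f t) _ =>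
      notypeclasses refine (H _)
  | H : forall t, is_derive t _ ?f _ |- is_derive _ _ ?f _ =>
      notypeclasses refine (H _)
  end.
(** The derivative is computed from the shape of the function, with local hypotheses used for
    unknown functions. What remains are the nonvanishing conditions of inverses, then the equality
    with the claimed derivative. *)
Ltac derive :=
  notypeclasses refine (@is_derive_eq _ _ _ _ _ _ _ _ _ _); [repeat derive_step|].

Section fundamental_solution.
Context {R : realType}.
Implicit Types (a b d t : R).

(** Solves [S'' = d S]: a sine for [d < 0], a hyperbolic sine for [d > 0], the identity for
    [d = 0]. *)
Lemma second_order_solution d : exists S S' : R -> R,
  [/\ forall t, is_derive t (1 : R) S (S' t),
      forall t, is_derive t (1 : R) S' (d * S t), S 0 = 0 & S' 0 = 1].
Proof.
have [d0|d0|->] := ltgtP d 0.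
- pose w := Num.sqrt (- d).
  have w0 : w != 0 by rewrite gt_eqF // sqrtr_gt0 oppr_gt0.
  have ww : w * w = - d by rewrite -expr2 sqr_sqrtr // oppr_ge0 ltW.
  exists (fun t => w^-1 * sin (w * t)), (fun t => cos (w * t)); split.
  + by move=> t; derive; rewrite /=; field.
  + move=> t; derive; have -> : d = - (w * w) by rewrite ww opprK.
    by rewrite /=; field.
  + by rewrite mulr0 sin0 mulr0.
  + by rewrite mulr0 cos0.
- pose w := Num.sqrt d.
  have w0 : w != 0 by rewrite gt_eqF // sqrtr_gt0.
  have ww : w * w = d by rewrite -expr2 sqr_sqrtr // ltW.
  exists (fun t => (2 * w)^-1 * (expR (w * t) - expR (- w * t))),
    (fun t => 2^-1 * (expR (w * t) + expR (- w * t))); split.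
  + by move=> t; derive; rewrite /=; field.
  + by move=> t; derive; rewrite -ww /=; field.
  + by rewrite !mulr0 expR0 subrr mulr0.
  + by rewrite !mulr0 expR0; field.
- by exists (fun t => t), (fun=> 1); split => // t; derive; rewrite ?mul0r.
Qed.

Definition fundamental_solution a b (phi psi : R -> R) :=
  [/\ forall t, is_derive t (1 : R) phi (psi t),
      forall t, is_derive t (1 : R) psi (- (a * psi t) - b * phi t),
      phi 0 = 0 & psi 0 = 1].

(** Factoring out [exp (- a t / 2)] removes the damping and leaves [S'' = (a^2 / 4 - b) S]; the sign
    of this coefficient separates real, double and complex poles. *)
Lemma fundamental_solution_exists a b :
  exists phi psi, fundamental_solution a b phi psi.
Proof.
have [S [S' [dS dS' S0 S'0]]] := second_order_solution (a * a / 4 - b).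
exists (fun t => expR (- (a / 2) * t) * S t),
  (fun t => expR (- (a / 2) * t) * (S' t - a / 2 * S t)); split.
- by move=> t; derive; rewrite /=; field.
- by move=> t; derive; rewrite /=; field.
- by rewrite S0 mulr0.
- by rewrite S0 S'0 !mulr0 expR0 subr0 mulr1.
Qed.

End fundamental_solution.

(** * Half-plane arcs: launch and landing speeds *)

Section half_return.
Context {R : realType} (a b : R) (phi psi : R -> R).
Hypotheses (a_gt0 : 0 < a) (b_gt0 : 0 < b).
Hypothesis fs : fundamental_solution a b phi psi.
Implicit Types s t : R.

Let dphi t : is_derive t (1 : R) phi (psi t).
Proof. by case: fs. Qed.

Let dpsi t : is_derive t (1 : R) psi (- (a * psi t) - b * phi t).
Proof. by case: fs. Qed.

Let phi0 : phi 0 = 0. Proof. by case: fs. Qed.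
Let psi0 : psi 0 = 1. Proof. by case: fs. Qed.
Let bN0 : b != 0. Proof. by rewrite gt_eqF. Qed.

(** The left side is [psi^2 - phi psi'], the Wronskian of [psi] and [phi]; its product with
    [exp (a t)] has zero derivative (Abel's identity). *)
Lemma wronskian t :
  psi t * psi t + a * phi t * psi t + b * phi t * phi t = expR (- (a * t)).
Proof.
pose h s := (psi s * psi s + a * phi s * psi s + b * phi s * phi s) * expR (a * s).
have E : h t = h 0.
  by apply: is_derive_0_is_cst => s; rewrite /h; derive; rewrite /=; ring.
rewrite /h phi0 psi0 !mulr0 !mul0r expR0 !addr0 !mulr1 in E.
by rewrite expRN -[LHS](mulfK (lt0r_neq0 (expR_gt0 (a * t)))) E mul1r.
Qed.

(** Damping dissipates the energy at the rate [2 a psi^2]. *)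
Lemma oscillator_energy_le s t : s <= t ->
  psi t * psi t + b * phi t * phi t <= psi s * psi s + b * phi s * phi s.
Proof.
move=> st; rewrite -lerN2.
refine (derive_nonneg_le (fun u => - (psi u * psi u + b * phi u * phi u))
  (fun u => 2 * a * psi u ^+ 2) s t st _ _).
  by move=> u _; derive; rewrite /=; ring.
by move=> u _; rewrite mulr_ge0 ?sqr_ge0 // mulr_ge0 // ltW.
Qed.

Lemma psi_norm_le1 t : 0 <= t -> `|psi t| <= 1.
Proof.
move=> t0; have := oscillator_energy_le 0 t t0.
rewrite phi0 psi0 !mulr0 mul1r addr0 => h.
have h1 : 0 <= b * phi t * phi t by rewrite -mulrA mulr_ge0 ?(ltW b_gt0) // -expr2 sqr_ge0.
rewrite -(@ler_pXn2r _ 2) ?nnegrE // expr1n real_normK ?num_real // expr2; lra.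
Qed.

(** The energy starts at 1, so [phi^2 <= 1 / b]; the cruder bound [1 + 1 / b] avoids a square
    root. *)
Lemma phi_norm_le t : 0 <= t -> `|phi t| <= 1 + b^-1.
Proof.
move=> t0; have := oscillator_energy_le 0 t t0.
rewrite phi0 psi0 !mulr0 mul1r addr0 => h.
have h1 : 0 <= psi t * psi t by rewrite -expr2 sqr_ge0.
have h2 : phi t ^+ 2 <= b^-1.
  rewrite -(@ler_pM2l _ b) // mulfV // expr2; lra.
have b1 : 0 < b^-1 by rewrite invr_gt0.
rewrite -(@ler_pXn2r _ 2) ?nnegrE ?addr_ge0 ?(ltW b1) // real_normK ?num_real //.
rewrite (le_trans h2) // expr2; nra.
Qed.

Lemma phi_psi_pos_right_of0 :
  exists2 e, 0 < e & forall t, 0 < t <= e -> 0 < phi t /\ 0 < psi t.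
Proof.
have cpsi : continuous psi by move=> x; exact: is_derive1_continuous.
have psi0_gt0 : 0 < psi 0 by rewrite psi0.
have [e e0 He] := pos_right_of0 phi psi dphi (cpsi 0) (or_intror (conj phi0 psi0_gt0)).
have [d d0 Hd] := continuous_pos psi 0 (cpsi 0) psi0_gt0.
exists (Num.min e (d / 2)); first by rewrite lt_min e0 divr_gt0.
move=> t /andP[t0]; rewrite le_min => /andP[te td]; split.
  by apply: He; rewrite t0.
by apply: Hd; rewrite subr0 gtr0_norm //; lra.
Qed.

(* The integral of phi from 0, in closed form. *)
Definition Phi t : R := (1 - a * phi t - psi t) / b.

Lemma is_derive_Phi t : is_derive t (1 : R) Phi (phi t).
Proof. by rewrite /Phi; derive; rewrite /=; field. Qed.

Lemma Phi0 : Phi 0 = 0.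
Proof. by rewrite /Phi phi0 psi0 mulr0 subr0 subrr mul0r. Qed.

Definition phi_pos T := forall s, 0 < s <= T -> 0 < phi s.

Lemma phi_pos_le s t : s <= t -> phi_pos t -> phi_pos s.
Proof. by move=> st P u /andP[u0 us]; apply: P; rewrite u0 (le_trans us). Qed.

Lemma Phi_gt0 t : 0 < t -> phi_pos t -> 0 < Phi t.
Proof.
move=> t0 P; rewrite -Phi0; refine (derive_pos_lt Phi phi 0 t t0 (fun u _ => is_derive_Phi u) _).
by move=> u /andP[u0 ut]; apply: P; rewrite u0 ltW.
Qed.

Let E t : R := expR (- (a * t)).

Lemma expR_Na_lt1 t : 0 < t -> E t < 1.
Proof. by move=> t0; rewrite /E expR_lt1 oppr_lt0 mulr_gt0. Qed.

(* Where psi + E > 0, the derivative of phi^2 / (psi + E) - Phi is positive;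
   (psi + E) / E is decreasing, so this region is an interval starting at 0. *)
Lemma Phi_mul_lt_sqr_phi t : 0 < t -> phi_pos t ->
  Phi t * (psi t + E t) < phi t * phi t.
Proof.
move=> t0 P.
have phit : 0 < phi t by apply: P; rewrite t0 lexx.
pose M s := psi s * expR (a * s) + 1.
have ME s : psi s + E s = M s * E s.
  by rewrite /M /E mulrDl mul1r -mulrA -expRD subrr expR0 mulr1.
have E0 s : 0 < E s by exact: expR_gt0.
have [M0|M0] := leP (M t) 0.
  rewrite (@le_lt_trans _ _ 0) ?mulr_gt0 // ME mulr_ge0_le0 ?(ltW (Phi_gt0 _ _ _)) //.
  by rewrite mulr_le0_ge0 ?(ltW (E0 _)).
have Mpos s : 0 <= s <= t -> 0 < psi s + E s.
  move=> /andP[s0 st]; rewrite ME mulr_gt0 // (lt_le_trans M0) // -lerN2.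
  refine (derive_nonneg_le (fun u => - M u) (fun u => b * phi u * expR (a * u)) s t st _ _).
    by move=> u _; rewrite /M; derive; rewrite /=; ring.
  move=> u /andP[su ut]; rewrite mulr_ge0 ?expR_ge0 // mulr_ge0 ?(ltW b_gt0) //.
  by rewrite ltW // P // (le_lt_trans s0 su) ltW.
pose h s := phi s * phi s * (psi s + E s)^-1 - Phi s.
(* This is the derivative of [h] once [wronskian] has eliminated [b * phi^2]; each factor is then
   positive on []0, t[]. *)
pose dh s := phi s * E s * (1 - E s + a * phi s) * (psi s + E s) ^- 2.
have : h 0 < h t.
  refine (derive_pos_lt h dh 0 t t0 _ _).
    move=> u ut; have Nu := lt0r_neq0 (Mpos u ut).
    have W : b * phi u * phi u = E u - psi u * psi u - a * phi u * psi u.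
      by rewrite /E -wronskian; ring.
    have dPhi := is_derive_Phi; rewrite /h /E; derive; first exact: Nu.
    transitivity (phi u * (2 * psi u * (psi u + E u) + a * phi u * (psi u + E u)
      + b * phi u * phi u) * (psi u + E u) ^- 2 - phi u); rewrite /= -/(E u).
      by field.
    by rewrite W /dh; field.
  move=> u /andP[u0 ut]; rewrite /dh.
  have pu : 0 < phi u by apply: P; rewrite u0 ltW.
  rewrite mulr_gt0 ?invr_gt0 ?exprn_gt0 ?Mpos ?(ltW u0) ?(ltW ut) //.
  rewrite mulr_gt0 ?mulr_gt0 // addr_gt0 ?mulr_gt0 //.
  by rewrite subr_gt0 expR_Na_lt1.
rewrite /h phi0 Phi0 !mul0r subr0 subr_gt0.
by rewrite ltr_pdivlMr // Mpos // (ltW t0) lexx.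
Qed.

(* An arc of duration t of w'' + a w' + b w = - gamma with w(0) = w(t) = 0 starts at speed
   gamma * launch t and ends at speed - gamma * landing t. *)
Definition launch t : R := Phi t / phi t.
Definition landing t : R := phi t - launch t * psi t.

(** With the next lemma, [launch] and [landing] form a closed differential system: while [phi > 0],
    each derivative is a positive multiple of the other function. *)
Lemma is_derive_launch t : phi t != 0 ->
  is_derive t (1 : R) launch (landing t / phi t).
Proof.
move=> p; have dPhi := is_derive_Phi; rewrite /launch; derive; first exact: p.
by rewrite /landing /launch; field.
Qed.

Lemma is_derive_landing t : phi t != 0 ->
  is_derive t (1 : R) landing (launch t * E t / phi t).
Proof.
move=> p; have dl := is_derive_launch t p; rewrite /landing.
derive; first exact: dl.
by rewrite /E -wronskian /landing; field.
Qed.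

Lemma phi_neq0 s t : 0 < s <= t -> phi_pos t -> phi s != 0.
Proof. by move=> st P; rewrite gt_eqF // P. Qed.

Lemma launch_gt0 t : 0 < t -> phi_pos t -> 0 < launch t.
Proof. by move=> t0 P; rewrite divr_gt0 ?Phi_gt0 // P // t0 lexx. Qed.

(** After multiplication by [phi t] this is [Phi_mul_lt_sqr_phi]. It says that [launch] has a larger
    derivative than [landing]. *)
Lemma launch_expR_lt_landing t : 0 < t -> phi_pos t ->
  launch t * E t < landing t.
Proof.
move=> t0 P; have p : 0 < phi t by apply: P; rewrite t0 lexx.
have L : launch t * phi t = Phi t by rewrite /launch divfK ?gt_eqF.
by rewrite -(ltr_pM2r p) /landing; have := Phi_mul_lt_sqr_phi t t0 P; rewrite -L; lra.
Qed.

Lemma landing_gt0 t : 0 < t -> phi_pos t -> 0 < landing t.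
Proof.
move=> t0 P; apply: le_lt_trans (launch_expR_lt_landing t t0 P).
by rewrite mulr_ge0 ?expR_ge0 ?(ltW (launch_gt0 _ _ _)).
Qed.

Lemma launch_lt s t : 0 < s -> s < t -> phi_pos t -> launch s < launch t.
Proof.
move=> s0 st P; refine (derive_pos_lt launch (fun u => landing u / phi u) s t st _ _).
  move=> u /andP[su ut]; apply: is_derive_launch; apply: (phi_neq0 u t) => //.
  by rewrite (lt_le_trans s0 su).
move=> u /andP[su ut]; have u0 := lt_trans s0 su.
by rewrite divr_gt0 ?landing_gt0 ?P ?u0 ?(ltW ut) //; apply: phi_pos_le P; exact: ltW.
Qed.

Lemma landing_lt s t : 0 < s -> s < t -> phi_pos t -> landing s < landing t.
Proof.
move=> s0 st P.
refine (derive_pos_lt landing (fun u => launch u * E u / phi u) s t st _ _).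
  move=> u /andP[su ut]; apply: is_derive_landing; apply: (phi_neq0 u t) => //.
  by rewrite (lt_le_trans s0 su).
move=> u /andP[su ut]; have u0 := lt_trans s0 su.
rewrite divr_gt0 ?P ?u0 ?(ltW ut) // mulr_gt0 ?expR_gt0 // launch_gt0 //.
by apply: phi_pos_le P; exact: ltW.
Qed.

Lemma launch_sub_landing_lt s t : 0 < s -> s < t -> phi_pos t ->
  launch s - landing s < launch t - landing t.
Proof.
move=> s0 st P.
refine (derive_pos_lt (fun u => launch u - landing u)
  (fun u => landing u / phi u - launch u * E u / phi u) s t st _ _).
  move=> u /andP[su ut]; have p : phi u != 0.
    by apply: (phi_neq0 u t) => //; rewrite (lt_le_trans s0 su).
  exact (is_derive_addf _ _ _ _ _ (is_derive_launch u p)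
    (is_derive_oppf _ _ _ (is_derive_landing u p))).
move=> u /andP[su ut]; have u0 := lt_trans s0 su.
rewrite -mulrBl divr_gt0 ?P ?u0 ?(ltW ut) // subr_gt0 launch_expR_lt_landing //.
by apply: phi_pos_le P; exact: ltW.
Qed.

(* [launch - landing = launch * (1 + psi) - phi], and the decay of energy keeps psi away
   from - 1 after any given positive time. *)
Lemma launch_sub_landing_unbounded K : exists V, forall t, 0 < t -> phi_pos t ->
  V <= launch t -> K <= launch t - landing t.
Proof.
have [e e0 He] := phi_psi_pos_right_of0.
have Pe : phi_pos e by move=> s /He[].
have [pe se] : 0 < phi e /\ 0 < psi e by apply: He; rewrite e0 lexx.
pose W := psi e * psi e + b * phi e * phi e.
have W1 : W < 1.
  have := wronskian e; have := expR_Na_lt1 e e0; rewrite /E => h1 h2.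
  have : 0 < a * phi e * psi e by rewrite !mulr_gt0.
  by rewrite /W; lra.
have W0 : 0 <= W by rewrite /W addr_ge0 ?mulr_ge0 // ltW.
(* From [psi^2 <= W] follows [(1 + psi) (1 - psi) >= 1 - W], and [1 - psi <= 2]; hence
   [1 + psi >= c]. *)
pose c := (1 - W) / 2.
have c0 : 0 < c by rewrite divr_gt0 // subr_gt0.
(* The first bound forces [e <= t], where the energy is at most [W]; the second makes [launch t * c]
   exceed [K] plus the bound on [phi]. *)
exists (Num.max (launch e) ((K + (1 + b^-1)) / c)) => t t0 P.
rewrite ge_max => /andP[Ve VK].
have et : e <= t.
  by rewrite leNgt; apply/negP => te; have := launch_lt t e t0 te Pe; rewrite ltNge Ve.
have Wt := oscillator_energy_le e t et; rewrite -/W in Wt.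
have b2 : 0 <= b * phi t * phi t by rewrite -mulrA mulr_ge0 ?(ltW b_gt0) // -expr2 sqr_ge0.
have s1 := psi_norm_le1 t (ltW t0); rewrite ler_norml in s1; case/andP: s1 => s1 s2.
have p1 := phi_norm_le t (ltW t0); rewrite ler_norml in p1; case/andP: p1 => _ p2.
have cs : c <= 1 + psi t.
  rewrite /c; have [s0|s0] := leP 0 (psi t); first by lra.
  nra.
rewrite ler_pdivrMr // in VK.
have l0 := launch_gt0 t t0 P.
have : launch t * c <= launch t * (1 + psi t) by rewrite ler_pM2l.
rewrite /landing; lra.
Qed.

(** The function is the output above the switching line from second coordinate [x2], where [v] is
    the first coordinate plus kappa; [Phi] solves the equation with right side 1 and zero initial
    data. *)
Lemma is_derive_arc gamma x2 v t :
  is_derive t (1 : R) (fun t => x2 * psi t + v * phi t - gamma * Phi t)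
    (x2 * (- (a * psi t) - b * phi t) + v * psi t - gamma * phi t).
Proof. by have dPhi := is_derive_Phi; derive; rewrite /=; ring. Qed.

(** An output that stayed positive would lie below a parabola opening downwards, hence could not
    stay positive; [first_zero] then gives the return time. *)
Lemma arc_return gamma x2 v : 0 < gamma -> 0 < x2 \/ x2 = 0 /\ 0 < v ->
  exists2 tau, 0 < tau &
    [/\ x2 * psi tau + v * phi tau - gamma * Phi tau = 0,
        forall t, 0 < t < tau -> 0 < x2 * psi t + v * phi t - gamma * Phi t &
        x2 * (- (a * psi tau) - b * phi tau) + v * psi tau - gamma * phi tau <= 0].
Proof.
move=> g0 xv.
pose w t := x2 * psi t + v * phi t - gamma * Phi t.
pose dw t := x2 * (- (a * psi t) - b * phi t) + v * psi t - gamma * phi t.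
have dwP t : is_derive t (1 : R) w (dw t) by exact: is_derive_arc.
have cw : continuous w by move=> t; exact: is_derive1_continuous (dwP t).
have cdw : continuous dw.
  move=> t; apply: (is_derive1_continuous _ _
    (x2 * (- (a * (- (a * psi t) - b * phi t)) - b * psi t)
    + v * (- (a * psi t) - b * phi t) - gamma * psi t)).
  by rewrite /dw; derive; rewrite /=; ring.
have w0 : w 0 = x2 by rewrite /w phi0 psi0 Phi0 !mulr0 mulr1 addr0 subr0.
have dw0 : dw 0 = v - a * x2 by rewrite /dw phi0 psi0; ring.
have x20 : 0 <= x2 by case: xv => [/ltW|[->]].
have [e e0 He] : exists2 e, 0 < e & forall t, 0 < t <= e -> 0 < w t.
  apply: (pos_right_of0 w dw dwP (cdw 0)); rewrite w0 dw0.
  by case: xv => [|[-> v0]]; [left|right; rewrite mulr0 subr0].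
have [T T0 wT] : exists2 T, 0 < T & w T <= 0.
  apply: contrapT => /forall2NP H.
  have wpos t : 0 < t -> 0 < w t by case: (H t) => // /negP; rewrite -ltNge.
  have w_ge0 t : 0 <= t -> 0 <= w t.
    by rewrite le_eqVlt => /predU1P[<-|/wpos/ltW//]; rewrite w0.
  (* [dw + a * w] is the first state coordinate plus kappa; its derivative is [- b * w - gamma], at
     most [- gamma] while [w >= 0]. *)
  have x1_le t : 0 <= t -> dw t + a * w t <= v - gamma * t.
    move=> t0; rewrite -lerN2.
    have -> : - (v - gamma * t) = - (v - gamma * t) + (- (dw 0 + a * w 0) + (v - gamma * 0)).
      by rewrite dw0 w0; ring.
    rewrite -lerBrDl -[v - gamma * 0]opprK.
    refine (derive_nonneg_le (fun u => - (dw u + a * w u) - - (v - gamma * u))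
      (fun u => b * w u) 0 t t0 _ _).
      move=> u _; have dPhi := is_derive_Phi; rewrite /dw /w; derive.
      by rewrite /Phi /=; field.
    by move=> u /andP[u0 _]; rewrite mulr_ge0 ?(ltW b_gt0) ?w_ge0 ?(ltW u0).
  have w_le t : 0 <= t -> w t <= x2 + v * t - gamma * t * t / 2.
    move=> t0; rewrite -subr_ge0.
    have -> : 0 = x2 + v * 0 - gamma * 0 * 0 / 2 - w 0 by rewrite w0; ring.
    refine (derive_nonneg_le (fun u => x2 + v * u - gamma * u * u / 2 - w u)
      (fun u => v - gamma * u - dw u) 0 t t0 _ _).
      by move=> u _; derive; rewrite /=; field.
    move=> u /andP[u0 _]; have := x1_le u (ltW u0).
    have := mulr_ge0 (ltW a_gt0) (w_ge0 u (ltW u0)); lra.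
  (* Chosen so that the parabola is negative at [T]: [gamma * T / 2] dominates [|v| + x2], and
     [T >= 1]. *)
  pose T := 1 + 2 * (`|v| + x2) / gamma.
  have n0 : 0 <= `|v| + x2 by rewrite addr_ge0.
  have T1 : 1 <= T by rewrite /T lerDl divr_ge0 ?mulr_ge0 // ltW.
  have T0 : 0 < T by apply: lt_le_trans T1.
  have gT : gamma * T = gamma + 2 * (`|v| + x2).
    by rewrite /T; field; rewrite gt_eqF.
  have := w_le T (ltW T0); rewrite leNgt => /negP; apply.
  apply: le_lt_trans (wpos T T0).
  rewrite gT; have := ler_norm v; nra.
have [tau tau0 [wtau Htau]] := first_zero w e T cw e0 He T0 wT.
(* A positive slope at the zero would make the output negative just before it. *)
exists tau => //; split => //; rewrite -/(dw tau) leNgt; apply/negP => d0.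
have [d d00 Hd] := continuous_pos dw tau (cdw tau) d0.
pose m := Num.min (d / 2) (tau / 2).
have m0 : 0 < m by rewrite lt_min !divr_gt0.
have m1 : m <= d / 2 by rewrite ge_min lexx.
have m2 : m <= tau / 2 by rewrite ge_min lexx orbT.
have mt : tau - m < tau by lra.
have : w (tau - m) < w tau.
  refine (derive_pos_lt w dw _ _ mt (fun t _ => dwP t) _).
  by move=> t /andP[t1 t2]; apply: Hd; rewrite ltr0_norm ?subr_lt0 //; lra.
have : 0 < w (tau - m) by apply: Htau; apply/andP; split; lra.
by rewrite wtau; lra.
Qed.

(** At the return [v * phi = gamma * Phi]. The substance is that [phi] does not vanish up to then,
    so that dividing by it yields [launch]. *)
Lemma arc_return_launch gamma v tau : 0 < gamma -> 0 < v -> 0 < tau ->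
  0 * psi tau + v * phi tau - gamma * Phi tau = 0 ->
  (forall t, 0 < t < tau -> 0 < 0 * psi t + v * phi t - gamma * Phi t) ->
  [/\ phi_pos tau, v = gamma * launch tau &
    0 * (- (a * psi tau) - b * phi tau) + v * psi tau - gamma * phi tau =
    - (gamma * landing tau)].
Proof.
move=> g0 v0 tau0 wtau Hw.
have [e e0 He] := phi_psi_pos_right_of0.
have Phi_phi t : 0 < t <= tau -> gamma * Phi t <= v * phi t.
  move=> /andP[t0]; rewrite le_eqVlt => /predU1P[->|tt]; first by lra.
  by have := Hw t; rewrite t0 tt => /(_ isT); lra.
(* Phi' = phi >= (gamma / v) Phi, so Phi stays positive. *)
have P : phi_pos tau.
  move=> t /andP[t0 tt].
  have [te|et] := leP t e; first by have [] := He t; rewrite ?t0.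
  have Pe : 0 < Phi e by apply: Phi_gt0 => // s /He[].
  pose k := gamma / v.
  have : Phi e * expR (- k * e) <= Phi t * expR (- k * t).
    refine (derive_nonneg_le (fun u => Phi u * expR (- k * u))
      (fun u => (phi u - k * Phi u) * expR (- k * u)) _ _ (ltW et) _ _).
      by move=> u _; have dPhi := is_derive_Phi; derive; rewrite /=; ring.
    move=> u /andP[eu ut]; rewrite mulr_ge0 ?expR_ge0 // subr_ge0 /k mulrAC ler_pdivrMr //.
    by rewrite mulrC [leRHS]mulrC mulrC Phi_phi // (lt_trans e0 eu) (le_trans (ltW ut)).
  move=> /(lt_le_trans (mulr_gt0 Pe (expR_gt0 _))).
  rewrite pmulr_lgt0 ?expR_gt0 // => Pt.
  rewrite -(pmulr_rgt0 _ v0); apply: lt_le_trans (Phi_phi t _); last by rewrite t0.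
  by rewrite mulr_gt0.
have p : phi tau != 0 by apply: (phi_neq0 tau tau) => //; rewrite tau0 lexx.
have vE : v = gamma * launch tau.
  rewrite /launch; apply: (mulIf p); rewrite -mulrA divfK //; lra.
by split => //; rewrite {1}vE /landing; ring.
Qed.

(** The witness is the return time of the arc launched at speed [v] with [gamma = 1]. *)
Lemma launch_surj v : 0 < v -> exists2 t, 0 < t & phi_pos t /\ launch t = v.
Proof.
move=> v0; have [t t0 [w0 Hw _]] := arc_return 1 0 v ltr01 (or_intror (conj erefl v0)).
have [P vE _] := arc_return_launch 1 v t ltr01 v0 t0 w0 Hw.
by exists t => //; rewrite vE mul1r.
Qed.

Lemma launch_lt_inv s t : 0 < s -> 0 < t -> phi_pos s -> phi_pos t ->
  (launch s <= launch t) = (s <= t).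
Proof.
move=> s0 t0 Ps Pt; apply/idP/idP.
  by rewrite !leNgt; apply: contra => ts; exact: launch_lt.
by rewrite le_eqVlt => /predU1P[->//|st]; rewrite ltW // launch_lt.
Qed.


Lemma launch_continuous t : 0 < t -> phi_pos t -> {for t, continuous launch}.
Proof.
move=> t0 P; apply: is_derive1_continuous (is_derive_launch t _).
by apply: (phi_neq0 t t) => //; rewrite t0 lexx.
Qed.

Lemma landing_continuous t : 0 < t -> phi_pos t -> {for t, continuous landing}.
Proof.
move=> t0 P; apply: is_derive1_continuous (is_derive_landing t _).
by apply: (phi_neq0 t t) => //; rewrite t0 lexx.
Qed.

(** Intermediate values: where [launch] equals [K] the difference is below [K] since [landing > 0],
    and where [launch] is large it is at least [K]. *)
Lemma launch_sub_landing_surj K : 0 < K ->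
  exists2 t, 0 < t & phi_pos t /\ launch t - landing t = K.
Proof.
move=> K0; have [V HV] := launch_sub_landing_unbounded K.
have [s s0 [Ps Es]] := launch_surj K K0.
pose V' := Num.max K V.
have V'0 : 0 < V' by rewrite lt_max K0.
have [t t0 [Pt Et]] := launch_surj V' V'0.
have st : s <= t by rewrite -launch_lt_inv // Es Et le_max lexx.
have gs : launch s - landing s <= K.
  by rewrite Es gerBl ltW // landing_gt0.
have gt : K <= launch t - landing t by apply: HV => //; rewrite Et le_max lexx orbT.
have sP u : u \in `[s, t]%R -> 0 < u /\ phi_pos u.
  rewrite in_itv /= => /andP[su ut]; split; first exact: lt_le_trans su.
  exact: phi_pos_le ut Pt.
have cont : {within `[s, t], continuous (fun u => launch u - landing u)}.
  apply: continuous_in_subspaceT => u; rewrite inE => /sP[u0 Pu].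
  by apply: continuousB; [exact: launch_continuous|exact: landing_continuous].
have [|u us uE] := IVT st cont (v := K).
  by rewrite ge_min gs le_max gt orbT.
by have [u0 Pu] := sP u us; exists u.
Qed.

Lemma launch_landing_cvg K tau (sigma : nat -> R) :
  0 < tau -> phi_pos tau -> launch tau - landing tau = K ->
  (forall n, 0 < sigma n /\ phi_pos (sigma n)) ->
  (forall n, launch (sigma n.+1) = landing (sigma n) + K) ->
  sigma n @[n --> \oo] --> tau.
Proof.
move=> tau0 Ptau tauE Hs rec.
have gap_le s t : 0 < s -> 0 < t -> phi_pos t -> phi_pos s ->
    launch s - landing s <= launch t - landing t -> s <= t.
  move=> s0 t0 Pt Ps; rewrite !leNgt; apply: contra => ts.
  exact: launch_sub_landing_lt.
(* By continuity a limit solves [launch - landing = K], and strict monotonicity leaves only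
   [tau]. *)
have lim l : 0 < l -> phi_pos l -> sigma n @[n --> \oo] --> l -> l = tau.
  move=> l0 Pl cl.
  have c1 : launch (sigma n.+1) @[n --> \oo] --> launch l.
    apply: (cvg_comp (fun n => sigma n.+1) launch); last exact: launch_continuous.
    by rewrite (cvg_shiftS sigma).
  have c2 : landing (sigma n) + K @[n --> \oo] --> landing l + K.
    apply: cvgD; last exact: cvg_cst.
    by apply: (cvg_comp sigma landing); [exact: cl|exact: landing_continuous].
  have lE : launch l = landing l + K.
    have fE : (fun n => launch (sigma n.+1)) = (fun n => landing (sigma n) + K).
      by apply/funext => n; rewrite rec.
    by rewrite fE in c1; exact: (cvg_unique _ c1 c2).
  apply/eqP; rewrite eq_le; apply/andP; split; apply: gap_le => //; rewrite ?tauE lE; lra.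
have [h|h] := leP (sigma 0%N) tau.
  have hn n : sigma n <= tau.
    elim: n => // n IH; have [s0 Ps] := Hs n; have [s0' Ps'] := Hs n.+1.
    rewrite -launch_lt_inv // rec -tauE.
    have : landing (sigma n) <= landing tau.
      move: IH; rewrite le_eqVlt => /predU1P[->//|st]; rewrite ltW // landing_lt //.
    by lra.
  (* By the recurrence this means that [launch - landing] at [sigma n] is at most [K], its value at
     [tau]. *)
  have inc n : sigma n <= sigma n.+1.
    have [s0 Ps] := Hs n; have [s0' Ps'] := Hs n.+1.
    rewrite -launch_lt_inv // rec -tauE.
    have : launch (sigma n) - landing (sigma n) <= launch tau - landing tau.
      have := hn n; rewrite le_eqVlt => /predU1P[->//|st]; rewrite ltW // launch_sub_landing_lt //.
    by lra.
  have nd : nondecreasing_seq sigma by apply/nondecreasing_seqP.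
  have cv : cvgn sigma.
    by apply: nondecreasing_is_cvgn => //; exists tau => _ [n _ <-].
  have l_le : limn sigma <= tau by apply: limr_le => //; exact: nearW.
  have l_ge : sigma 0%N <= limn sigma by apply: nondecreasing_cvgn_le.
  rewrite -(lim (limn sigma)) //; first exact: lt_le_trans (Hs 0%N).1 l_ge.
  exact: phi_pos_le l_le Ptau.
have hn n : tau <= sigma n.
  elim: n => [|n IH]; first exact: ltW.
  have [s0 Ps] := Hs n; have [s0' Ps'] := Hs n.+1.
  rewrite -launch_lt_inv // rec -tauE.
  have : landing tau <= landing (sigma n).
    move: IH; rewrite le_eqVlt => /predU1P[->//|st]; rewrite ltW // landing_lt //.
  by lra.
have dec n : sigma n.+1 <= sigma n.
  have [s0 Ps] := Hs n; have [s0' Ps'] := Hs n.+1.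
  rewrite -launch_lt_inv // rec -tauE.
  have : launch tau - landing tau <= launch (sigma n) - landing (sigma n).
    have := hn n; rewrite le_eqVlt => /predU1P[->//|st]; rewrite ltW // launch_sub_landing_lt //.
  by lra.
have ni : nonincreasing_seq sigma by apply/nonincreasing_seqP.
have cv : cvgn sigma.
  by apply: nonincreasing_is_cvgn => //; exists tau => _ [n _ <-].
have l_ge : tau <= limn sigma by apply: limr_ge => //; exact: nearW.
have l_le : limn sigma <= sigma 0%N by apply: nonincreasing_cvgn_ge.
by rewrite -(lim (limn sigma)) //; [exact: lt_le_trans tau0 l_ge|exact: phi_pos_le l_le (Hs 0%N).2].
Qed.

End half_return.

(** * Piecewise Filippov trajectories *)

Section piecewise_trajectories.
Context {R : realType}.
Implicit Types (x F : R -> 'cV[R]_2) (t : nat -> R).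

Definition lipschitz_between (s u : R) x :=
  exists L, forall p q, s <= p -> p <= q -> q <= u -> `|x q - x p| <= L * (q - p).

Lemma lipschitz_between_glue s m u x :
  lipschitz_between s m x -> lipschitz_between m u x -> lipschitz_between s u x.
Proof.
move=> [L HL] [M HM]; exists (Num.max L M) => p q sp pq qu.
have LM : L <= Num.max L M by rewrite le_max lexx.
have ML : M <= Num.max L M by rewrite le_max lexx orbT.
have [qm|mq] := leP q m.
  by apply: le_trans (HL _ _ sp pq qm) _; rewrite ler_wpM2r // subr_ge0.
have [mp|pm] := leP m p.
  by apply: le_trans (HM _ _ mp pq qu) _; rewrite ler_wpM2r // subr_ge0.
have -> : x q - x p = (x q - x m) + (x m - x p) by rewrite addrA subrK.
apply: le_trans (ler_normD _ _) _.
have h1 := HL _ _ sp (ltW pm) (lexx m).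
have h2 := HM _ _ (lexx m) (ltW mq) qu.
have : L * (m - p) <= Num.max L M * (m - p) by rewrite ler_wpM2r // subr_ge0 ltW.
have : M * (q - m) <= Num.max L M * (q - m) by rewrite ler_wpM2r // subr_ge0 ltW.
lra.
Qed.

Lemma lipschitz_absolutely_continuous b x :
  lipschitz_between 0 b x -> absolutely_continuous_on 0 b x.
Proof.
move=> [L HL] e e0; have L1 : 0 < `|L| + 1 by rewrite ltr_wpDl.
exists (e / (`|L| + 1)); first by rewrite divr_gt0.
move=> n l r lr _; rewrite ltr_pdivlMr // => H.
apply: le_lt_trans H; rewrite mulr_suml; apply: ler_sum => i _.
have [l0 lri rb] := lr i; apply: le_trans (HL _ _ l0 lri rb) _.
by rewrite mulrC ler_wpM2l ?subr_ge0 // (le_trans (ler_norm L)) // lerDl ler01.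
Qed.

(** The switching instants form a countable, hence null, set; at any other time [x] agrees locally
    with a differentiable piece. Absolute continuity comes from gluing the Lipschitz bounds. *)
Lemma trajectory_of_pieces A B C x t : t 0%N = 0 ->
  (forall n, t n < t n.+1) -> (forall M, exists n, M < t n) ->
  (forall n, exists F dF, [/\ forall s, is_derive s (1 : R) F (dF s),
     lipschitz_between (t n) (t n.+1) F,
     forall s, t n <= s <= t n.+1 -> x s = F s &
     forall s, t n < s < t n.+1 -> filippov A B C (F s) (dF s)]) ->
  trajectory A B C x.
Proof.
move=> t0 tS tub pieces; split.
  move=> c c0; apply: lipschitz_absolutely_continuous.
  have L n : lipschitz_between 0 (t n) x.
    elim: n => [|n IH].
      rewrite t0; exists 0 => p q p0 pq q0.
      have -> : p = q by lra.
      by rewrite subrr normr0 mul0r.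
    apply: lipschitz_between_glue IH _.
    have [F [dF [_ [M HM] xF _]]] := pieces n; exists M => p q tp pq qt.
    rewrite !xF; first exact: HM.
      by rewrite tp (le_trans pq).
    by rewrite qt (le_trans tp).
  have [n cn] := tub c; have [M HM] := L n; exists M => p q p0 pq qc.
  by apply: HM => //; apply: le_trans qc (ltW cn).
exists (range t); split.
- by apply: countable_measurable; [exact: measurable_set1|exact: card_image_le].
- by apply: countable_lebesgue_measure0; exact: card_image_le.
move=> s /= Hs; apply: contrapT => st; apply: Hs => s0.
have ex : exists n, s < t n.+1.
  have [n sn] := tub s; exists n; exact: lt_trans (tS n).
(* Minimality of [n] gives [t n <= s]; the inequality is strict because [s] is not a switching
   instant. *)
case: (ex_minnP ex) => n sn minn.
have tns : t n < s.
  rewrite lt_neqAle; apply/andP; split; first by apply/eqP => E; apply: st; exists n.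
  case: n minn {sn} => [_|n minn]; first by rewrite t0.
  by rewrite leNgt; apply/negP => /minn; rewrite ltnn.
have [F [dF [dFP _ xF fF]]] := pieces n; exists (dF s).
  apply: near_eq_is_derive (dFP s).
  have : s \in `](t n), (t n.+1)[%R by rewrite in_itv /= tns sn.
  move=> /near_in_itvoo; apply: filterS => u; rewrite in_itv /= => /andP[u1 u2].
  by rewrite xF // !ltW.
by rewrite xF ?(ltW tns) ?(ltW sn) //; apply: fF; rewrite tns.
Qed.

End piecewise_trajectories.

(** * The limit cycle and its attractivity *)

Section plane_vectors.
Context {R : realType}.
Implicit Types x y : R.

Definition vec x y : 'cV[R]_2 := \col_(i < 2) if i == 0 then x else y.

Lemma vec_eta (z : 'cV[R]_2) : z = vec (z 0 0) (z 1 0).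
Proof.
apply/matrixP => i j; rewrite !mxE (ord1 j).
by case: i => [[|[|i]] Hi] //=; congr (z _ _); apply/val_inj.
Qed.

Lemma vecD x y x' y' : vec x y + vec x' y' = vec (x + x') (y + y').
Proof. by apply/matrixP => i j; rewrite !mxE; case: ifP. Qed.

Lemma vecN x y : - vec x y = vec (- x) (- y).
Proof. by apply/matrixP => i j; rewrite !mxE; case: ifP. Qed.

Lemma vecB x y x' y' : vec x y - vec x' y' = vec (x - x') (y - y').
Proof. by rewrite vecN vecD. Qed.

Lemma plantC_mul (z : 'cV[R]_2) : (plantC *m z) 0 0 = z 1 0.
Proof.
rewrite !mxE !big_ord_recl big_ord0 !mxE /= mul0r mul1r add0r addr0.
by congr (z _ _); apply/val_inj.
Qed.

Lemma norm_vec_le x y : `|vec x y| <= `|x| + `|y|.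
Proof.
rewrite [leLHS]/Num.Def.normr /= mx_normrE; apply: bigmax_le => [|i _].
  by rewrite addr_ge0.
by rewrite !mxE; case: ifP => _; rewrite ?lerDl ?lerDr.
Qed.

Lemma is_derive_vec (X Y : R -> R) s dX dY : is_derive s (1 : R) X dX ->
  is_derive s (1 : R) Y dY ->
  is_derive s (1 : R) (fun u => vec (X u) (Y u)) (vec dX dY).
Proof.
move=> [dX1 dX2] [dY1 dY2].
have E i j : (fun u => vec (X u) (Y u) i j) = if i == 0 then X else Y.
  by apply/funext => u; rewrite mxE; case: ifP.
have D : derivable (fun u => vec (X u) (Y u)) s (1 : R).
  by apply/derivable_mxP => i j; rewrite E; case: ifP => _; [exact: dX1|exact: dY1].
split => //; rewrite derive_mx //; apply/matrixP => i j.
by rewrite !mxE E; case: ifP.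
Qed.

End plane_vectors.

(** * Arcs of the relay system and their concatenation *)

Section relay_arcs.
Context {R : realType} (a b kappa gamma : R) (phi psi : R -> R) (A : 'M[R]_2).
Hypotheses (a_gt0 : 0 < a) (b_gt0 : 0 < b) (kappa_gt0 : 0 < kappa)
  (gamma_gt0 : 0 < gamma).
Hypothesis fs : fundamental_solution a b phi psi.
Hypothesis AE : forall x y : R, A *m vec x y = vec (- (b * y)) (x - a * y).
Implicit Types (z : R * R) (s t : R).

Let B := plantB kappa gamma.
Let C : 'rV[R]_2 := plantC.
Local Notation Phi := (Phi a b phi psi).
Local Notation launch := (launch a b phi psi).
Local Notation landing := (landing a b phi psi).

Let BE : B = vec gamma (- kappa). Proof. by []. Qed.

Definition arc_output z t := z.2 * psi t + (z.1 + kappa) * phi t - gamma * Phi t.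
Definition arc_output' z t :=
  z.2 * (- (a * psi t) - b * phi t) + (z.1 + kappa) * psi t - gamma * phi t.
(** The first coordinate is recovered from the second row of the dynamics,
    [x2' = x1 - a x2 + kappa]. *)
Definition arc z t :=
  vec (arc_output' z t + a * arc_output z t - kappa) (arc_output z t).

Let dphi t : is_derive t (1 : R) phi (psi t).
Proof. by case: fs. Qed.
Let dpsi t : is_derive t (1 : R) psi (- (a * psi t) - b * phi t).
Proof. by case: fs. Qed.

Lemma is_derive_arc_output z t :
  is_derive t (1 : R) (arc_output z) (arc_output' z t).
Proof. exact: (is_derive_arc a b phi psi b_gt0 fs). Qed.

Lemma is_derive_arc_state z t :
  is_derive t (1 : R) (fun u => arc_output' z u + a * arc_output z u - kappa)
    (- (b * arc_output z t) - gamma).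
Proof.
have dw := is_derive_arc_output z; derive.
  by rewrite /arc_output'; derive; reflexivity.
by rewrite /arc_output /arc_output' /Phi /=; field; rewrite gt_eqF.
Qed.

Lemma arc0 z : arc z 0 = vec z.1 z.2.
Proof.
have [_ _ p0 s0] := fs.
have P0 : Phi 0 = 0 := Phi0 _ _ _ _ fs.
by rewrite /arc /arc_output' /arc_output P0 p0 s0; congr vec; ring.
Qed.

Lemma arc_fieldE z t : A *m arc z t - B =
  vec (- (b * arc_output z t) - gamma) (arc_output' z t).
Proof. by rewrite /arc AE BE vecB; congr vec; ring. Qed.

Lemma is_derive_arc_shift z c s :
  is_derive s (1 : R) (fun u => arc z (u - c)) (A *m arc z (s - c) - B).
Proof.
have shift : is_derive s (1 : R) (fun u => u - c) 1 by derive; rewrite addr0.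
rewrite arc_fieldE -[X in vec X _]mulr1 -[X in vec _ X]mulr1.
exact (is_derive_vec _ _ _ _ _
  (is_derive_compf _ (fun u => u - c) s _ _ (is_derive_arc_state z (s - c)) shift)
  (is_derive_compf _ (fun u => u - c) s _ _ (is_derive_arc_output z (s - c)) shift)).
Qed.

(** The energy bounds make the velocity bounded on all of [[0, +oo[]. *)
Lemma arc_lipschitz z : exists L, forall s u, 0 <= s -> s <= u ->
  `|arc z u - arc z s| <= L * (u - s).
Proof.
have b1 : 0 < b^-1 by rewrite invr_gt0.
pose M := 1 + b^-1.
have Mphi t : 0 <= t -> `|phi t| <= M by exact: (phi_norm_le _ _ _ _ a_gt0 b_gt0 fs).
have Mpsi t : 0 <= t -> `|psi t| <= 1 by exact: (psi_norm_le1 _ _ _ _ a_gt0 b_gt0 fs).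
have M0 : 0 <= M by rewrite addr_ge0 // ltW.
pose N := (1 + a * M + 1) / b.
have MPhi t : 0 <= t -> `|Phi t| <= N.
  move=> t0; rewrite /Phi normrM normfV [`|b|]gtr0_norm // ler_pM2r //.
  apply: le_trans (ler_normB _ _) _; rewrite lerD ?Mpsi //.
  apply: le_trans (ler_normB _ _) _; rewrite normr1 lerD2l normrM gtr0_norm //.
  by rewrite ler_pM2l // Mphi.
pose L1 := `|z.2| + `|z.1 + kappa| * M + gamma * N.
pose L2 := `|z.2| * (a + b * M) + `|z.1 + kappa| + gamma * M.
have H1 t : 0 <= t -> `|arc_output z t| <= L1.
  move=> t0; apply: le_trans (ler_normB _ _) _; rewrite lerD //; last first.
    by rewrite normrM gtr0_norm // ler_pM2l // MPhi.
  apply: le_trans (ler_normD _ _) _; rewrite !normrM lerD //.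
    by rewrite -[leRHS]mulr1 ler_wpM2l // Mpsi.
  by rewrite ler_wpM2l // Mphi.
have H2 t : 0 <= t -> `|arc_output' z t| <= L2.
  move=> t0; apply: le_trans (ler_normB _ _) _; rewrite lerD //; last first.
    by rewrite normrM gtr0_norm // ler_pM2l // Mphi.
  apply: le_trans (ler_normD _ _) _; rewrite !normrM lerD //.
    rewrite ler_wpM2l //; apply: le_trans (ler_normB _ _) _.
    rewrite normrN !normrM [`|a|]gtr0_norm // [`|b|]gtr0_norm // lerD //.
      by rewrite -[leRHS]mulr1 ler_pM2l // Mpsi.
    by rewrite ler_pM2l // Mphi.
  by rewrite -[leRHS]mulr1 ler_wpM2l // Mpsi.
exists (b * L1 + gamma + L2) => s u s0 su.
rewrite /arc vecB; apply: le_trans (norm_vec_le _ _) _; rewrite mulrDl lerD //.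
  refine (derive_bound_lipschitz
    (fun u => arc_output' z u + a * arc_output z u - kappa)
    (fun t => - (b * arc_output z t) - gamma) _ _ _ (fun t _ => is_derive_arc_state z t) _ su).
  move=> t /andP[st _]; apply: le_trans (ler_normB _ _) _.
  rewrite normrN [`|gamma|]gtr0_norm // lerD2r normrM [`|b|]gtr0_norm // ler_pM2l //.
  by rewrite H1 // (le_trans s0).
refine (derive_bound_lipschitz (arc_output z) (arc_output' z) _ _ _
  (fun t _ => is_derive_arc_output z t) _ su) => t /andP[st _].
by rewrite H2 // (le_trans s0).
Qed.

(** Arcs depend affinely on the initial state, so the forcing cancels in the difference and a
    bounded homogeneous solution remains. *)
Lemma arc_initial_lipschitz : exists K, forall r r' t, 0 <= t ->
  `|arc (r, 0) t - arc (r', 0) t| <= K * `|r - r'|.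
Proof.
have b1 : 0 < b^-1 by rewrite invr_gt0.
pose M := 1 + b^-1.
exists (1 + a * M + M) => r r' t t0.
have Mphi : `|phi t| <= M by exact: (phi_norm_le _ _ _ _ a_gt0 b_gt0 fs).
have Mpsi : `|psi t| <= 1 by exact: (psi_norm_le1 _ _ _ _ a_gt0 b_gt0 fs).
have -> : arc (r, 0) t - arc (r', 0) t =
    vec ((r - r') * (psi t + a * phi t)) ((r - r') * phi t).
  by rewrite /arc vecB /arc_output' /arc_output /=; congr vec; ring.
apply: le_trans (norm_vec_le _ _) _; rewrite !normrM -mulrDr mulrC ler_wpM2r //.
rewrite lerD //; apply: le_trans (ler_normD _ _) _.
by rewrite lerD // normrM gtr0_norm // ler_pM2l.
Qed.

Lemma filippov_upper (m : nat) z t : 0 < arc_output z t ->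
  filippov A B C ((-1) ^+ m *: arc z t) ((-1) ^+ m *: (A *m arc z t - B)).
Proof.
move=> w0; rewrite -signr_odd; case: (odd m); rewrite ?expr1 ?expr0.
  rewrite !scaleN1r /filippov plantC_mul !mxE /= ltrNr oppr0 ltNge (ltW w0) /=.
  by rewrite oppr_lt0 w0 /= mulmxN opprB addrC.
by rewrite !scale1r /filippov plantC_mul !mxE /= w0.
Qed.

(** All arcs are described above the line; the sign puts them alternately above and below, and the
    parity of [m] selects the side of the first. *)
Lemma orbit_trajectory (x : R -> 'cV[R]_2) (z : nat -> R * R) (tau t : nat -> R)
    (m : nat) :
  t 0%N = 0 -> (forall n, t n.+1 = t n + tau n) -> (forall n, 0 < tau n) ->
  (forall M, exists n, M < t n) ->
  (forall n s, 0 <= s <= tau n -> x (t n + s) = (-1) ^+ (n + m) *: arc (z n) s) ->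
  (forall n s, 0 < s < tau n -> 0 < arc_output (z n) s) ->
  trajectory A B C x.
Proof.
move=> t0 tS tau0 tub xE wpos; apply: (trajectory_of_pieces A B C x t) => //.
  by move=> n; rewrite tS ltrDl.
move=> n; exists (fun s => (-1) ^+ (n + m) *: arc (z n) (s - t n)),
  (fun s => (-1) ^+ (n + m) *: (A *m arc (z n) (s - t n) - B)); split.
- by move=> s; apply: is_deriveZ; exact: is_derive_arc_shift.
- have [L HL] := arc_lipschitz (z n); exists L => p q tp pq _.
  rewrite -scalerBr normrZ normrX normrN1 expr1n mul1r.
  have -> : q - p = (q - t n) - (p - t n) by ring.
  by apply: HL; [rewrite subr_ge0|rewrite lerD2r].
- move=> s /andP[ts st]; rewrite -xE; first by rewrite addrC subrK.
  by rewrite subr_ge0 ts lerBlDl -tS.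
- move=> s /andP[ts st]; apply: filippov_upper; apply: wpos.
  by rewrite subr_gt0 ts ltrBlDl -tS.
Qed.

Lemma concatenation (V : Type) (p : nat -> R -> V) (tau t : nat -> R) :
  t 0%N = 0 -> (forall n, t n.+1 = t n + tau n) -> (forall n, 0 < tau n) ->
  (forall M, exists n, M < t n) -> (forall n, p n (tau n) = p n.+1 0) ->
  exists x : R -> V, forall n s, 0 <= s <= tau n -> x (t n + s) = p n s.
Proof.
move=> t0 tS tau0 tub pp.
have tlt n k : (n < k)%N -> t n < t k.
  elim: k => // k IH; rewrite ltnS leq_eqVlt => /predU1P[->|/IH h].
    by rewrite tS ltrDl.
  by rewrite tS ltr_wpDr // ltW.
have ex s : exists n, s < t n.+1.
  by have [n sn] := tub s; exists n; apply: lt_trans sn _; exact: tlt.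
exists (fun s => let n := ex_minn (ex s) in p n (s - t n)).
have main n s : 0 <= s < tau n ->
    (let k := ex_minn (ex (t n + s)) in p k (t n + s - t k)) = p n s.
  move=> /andP[s0 sn] /=; case: ex_minnP => k tk mink.
  have kn : (k <= n)%N by apply: mink; rewrite tS ltrD2l.
  suff -> : k = n by rewrite addrAC subrr add0r.
  apply/eqP; rewrite eqn_leq kn leqNgt; apply/negP => kln.
  have : t k.+1 <= t n.
    by move: kln; rewrite leq_eqVlt => /predU1P[->//|/tlt/ltW].
  by move: tk s0; lra.
(* At the right end of piece [n] the glued function already uses piece [n.+1]; the matching
   condition reconciles them. *)
move=> n s /andP[s0]; rewrite le_eqVlt => /predU1P[->|sn].
  by rewrite -tS -[t n.+1]addr0 main ?lexx ?tau0.
by apply: main; rewrite s0.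
Qed.


(** The states from which an arc enters the upper half-plane; on the line the output leaves with
    slope [z.1 + kappa]. *)
Definition admissible z := 0 < z.2 \/ z.2 = 0 /\ 0 < z.1 + kappa.

Lemma arc_return_state z : admissible z -> exists w : R * (R * R),
  [/\ 0 < w.1, forall s, 0 < s < w.1 -> 0 < arc_output z s,
      arc z w.1 = - vec w.2.1 w.2.2, w.2.2 = 0 /\ kappa <= w.2.1 &
      z.2 = 0 -> [/\ phi_pos phi w.1, z.1 + kappa = gamma * launch w.1 &
                     w.2.1 + kappa = gamma * landing w.1 + 2 * kappa]].
Proof.
move=> adm.
have [tau tau0 [wtau Hw dw]] :=
  arc_return _ _ _ _ a_gt0 b_gt0 fs gamma z.2 (z.1 + kappa) gamma_gt0 adm.
(* The duration, followed by the end state reflected through the origin, from which the next arc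
   starts; its abscissa is at least kappa since the output lands with nonpositive slope. *)
exists (tau, (kappa - arc_output' z tau, 0)); split => //=.
- rewrite vecN /arc; congr vec; last by rewrite oppr0; exact: wtau.
  by rewrite {1}/arc_output wtau; ring.
- by split => //; rewrite lerDl oppr_ge0; exact: dw.
move=> z20; have v0 : 0 < z.1 + kappa by case: adm => [|[]//]; rewrite z20 ltxx.
have H := arc_return_launch _ _ _ _ b_gt0 fs gamma (z.1 + kappa) tau gamma_gt0 v0 tau0.
rewrite z20 in wtau Hw; have [P vE dE] := H wtau Hw; split => //.
by rewrite /arc_output' z20 dE; ring.
Qed.

Lemma orbit_exists z0 : admissible z0 ->
  exists (z : nat -> R * R) (tau : nat -> R),
  [/\ z 0%N = z0, forall n, 0 < tau n,
      forall n s, 0 < s < tau n -> 0 < arc_output (z n) s,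
      forall n, arc (z n) (tau n) = - vec (z n.+1).1 (z n.+1).2 &
      forall n, [/\ (z n.+1).2 = 0, kappa <= (z n.+1).1, phi_pos phi (tau n.+1),
        (z n.+1).1 + kappa = gamma * launch (tau n.+1) &
        (z n.+2).1 + kappa = gamma * landing (tau n.+1) + 2 * kappa]].
Proof.
move=> adm0.
have ex z : exists w : R * (R * R), admissible z ->
  [/\ 0 < w.1, forall s, 0 < s < w.1 -> 0 < arc_output z s,
      arc z w.1 = - vec w.2.1 w.2.2, w.2.2 = 0 /\ kappa <= w.2.1 &
      z.2 = 0 -> [/\ phi_pos phi w.1, z.1 + kappa = gamma * launch w.1 &
                     w.2.1 + kappa = gamma * landing w.1 + 2 * kappa]].
  have [/arc_return_state[w Hw]|nadm] := pselect (admissible z); first by exists w.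
  (* A default value, never reached: reflected end states are again admissible. *)
  by exists (0, (0, 0)).
have [step Hstep] := choice ex.
pose z n := iter n (fun z => (step z).2) z0.
have adm n : admissible (z n).
  elim: n => // n IH; have [_ _ _ [h1 h2] _] := Hstep _ IH.
  by right; split => //; rewrite ltr_wpDl // (le_trans (ltW kappa_gt0)).
exists z, (fun n => (step (z n)).1); split => //.
- by move=> n; case: (Hstep _ (adm n)).
- by move=> n; case: (Hstep _ (adm n)).
- by move=> n; case: (Hstep _ (adm n)).
move=> n; have [_ _ _ [h1 h2] _] := Hstep _ (adm n).
by have [_ _ _ _ /(_ h1)[? ? ?]] := Hstep _ (adm n.+1).
Qed.

(** * The limit cycle: periodicity, symmetry, unimodality, attractivity *)

Section limit_cycle.
Variable tau : R.
Hypotheses (tau0 : 0 < tau) (Ptau : phi_pos phi tau).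
Hypothesis tauE : launch tau - landing tau = 2 * kappa / gamma.

Let r := gamma * launch tau - kappa.

Lemma landing_balance : gamma * landing tau = gamma * launch tau - 2 * kappa.
Proof.
have -> : landing tau = launch tau - 2 * kappa / gamma by rewrite -tauE; ring.
by field; rewrite gt_eqF.
Qed.

Lemma limit_cycle_abscissa_gt0 : 0 < r.
Proof.
have := landing_gt0 _ _ _ _ a_gt0 b_gt0 fs tau tau0 Ptau.
by rewrite /r -(pmulr_rgt0 _ gamma_gt0) landing_balance; move: kappa_gt0; lra.
Qed.

Lemma limit_arc_end : arc (r, 0) tau = - vec r 0.
Proof.
have p : phi tau != 0 by rewrite gt_eqF // Ptau // tau0 lexx.
have w0 : arc_output (r, 0) tau = 0.
  by rewrite /arc_output /r /launch /=; field.
have dw : arc_output' (r, 0) tau = - (gamma * landing tau).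
  by rewrite /arc_output' /r /landing /=; ring.
by rewrite vecN /arc w0 dw landing_balance /r; congr vec; ring.
Qed.

(** The output equals [gamma * (launch tau - launch s) * phi s], and [launch] increases. *)
Lemma limit_arc_pos s : 0 < s < tau -> 0 < arc_output (r, 0) s.
Proof.
move=> /andP[s0 st].
have ps : 0 < phi s by rewrite Ptau // s0 ltW.
have := launch_lt _ _ _ _ a_gt0 b_gt0 fs s tau s0 st Ptau.
rewrite -(ltr_pM2l gamma_gt0) -(ltr_pM2r ps) -subr_gt0.
have -> // : gamma * launch tau * phi s - gamma * launch s * phi s = arc_output (r, 0) s.
by rewrite /arc_output /r {2}/launch /=; field; rewrite gt_eqF.
Qed.

(** The antiperiodic extension of one arc; the exponent is an integer, so negative times are covered
    too. *)
Definition limit_orbit (t : R) : 'cV[R]_2 :=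
  let k := Num.floor (t / tau) in (-1) ^ k *: arc (r, 0) (t - k%:~R * tau).

Lemma limit_orbitD t : limit_orbit (t + tau) = - limit_orbit t.
Proof.
rewrite /limit_orbit mulrDl divff ?gt_eqF //.
have -> : Num.floor (t / tau + 1) = Num.floor (t / tau) + 1.
  by rewrite floorDrz ?floor1.
rewrite expfzDr ?oppr_eq0 ?oner_eq0 // expr1z mulrN1 scaleNr intrD mulrDl mul1r.
by congr (- (_ *: arc _ _)); ring.
Qed.

Lemma limit_orbit_nat n s : 0 <= s <= tau ->
  limit_orbit (n%:R * tau + s) = (-1) ^+ n *: arc (r, 0) s.
Proof.
elim: n s => [|n IH] s /andP[s0]; last first.
  move=> st; rewrite -natr1 mulrDl mul1r addrAC limit_orbitD IH ?s0 // exprS.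
  by rewrite mulN1r scaleNr.
have lt0 u : 0 <= u < tau -> limit_orbit u = arc (r, 0) u.
  move=> /andP[u0 ut]; rewrite /limit_orbit.
  have -> : Num.floor (u / tau) = 0.
    by apply/floor_def; rewrite divr_ge0 ?(ltW tau0) //= ltr_pdivrMr // mul1r.
  by rewrite expr0z scale1r mul0r subr0.
rewrite mul0r add0r expr0 scale1r le_eqVlt => /predU1P[->|st].
  by rewrite -[tau in LHS]add0r limit_orbitD lt0 ?lexx ?tau0 // arc0 limit_arc_end.
by apply: lt0; rewrite s0.
Qed.

Lemma limit_orbit_arc n s : 0 <= s <= tau ->
  range limit_orbit ((-1) ^+ n *: arc (r, 0) s).
Proof. by move=> st; exists (n%:R * tau + s) => //; exact: limit_orbit_nat. Qed.

Lemma mul_tau_unbounded M : exists n : nat, M < n%:R * tau.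
Proof.
exists (Num.truncn (`|M| / tau)).+1; rewrite -ltr_pdivrMr //.
apply: le_lt_trans (truncnS_gt _).
by rewrite ler_pM2r ?invr_gt0 // ler_norm.
Qed.

Lemma limit_orbit_trajectory : trajectory A B C limit_orbit.
Proof.
apply: (orbit_trajectory limit_orbit (fun=> (r, 0)) (fun=> tau) (fun n => n%:R * tau) 0) => //.
- by rewrite mul0r.
- by move=> n; rewrite -natr1 mulrDl mul1r.
- exact: mul_tau_unbounded.
- by move=> n s st; rewrite addn0 limit_orbit_nat.
- by move=> _ s; exact: limit_arc_pos.
Qed.

Lemma nat_tau_split t : 0 <= t -> exists (n : nat) s, t = n%:R * tau + s /\ 0 <= s < tau.
Proof.
move=> t0; exists (Num.truncn (t / tau)), (t - (Num.truncn (t / tau))%:R * tau).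
split; first by ring.
have /andP[h1 h2] := truncn_itv (divr_ge0 t0 (ltW tau0)).
rewrite ler_pdivlMr // in h1; rewrite ltr_pdivrMr // -natr1 mulrDl mul1r in h2.
by apply/andP; split; lra.
Qed.

Lemma limit_orbit_output n s : 0 <= s < tau ->
  relay_output C limit_orbit (n%:R * tau + s) = if s == 0 then 0 else - (-1) ^+ n.
Proof.
move=> /andP[s0 st]; rewrite /relay_output plantC_mul limit_orbit_nat ?s0 ?ltW // !mxE /=.
rewrite sgrM sgrX sgrN1; have [->|sN0] := eqVneq s 0.
  have := arc0 (r, 0) => /matrixP/(_ 1 0); rewrite !mxE /= => ->.
  by rewrite sgr0 mulr0 oppr0.
by rewrite [Num.sg _]gtr0_sg ?mulr1 // limit_arc_pos // lt_def sN0 s0.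
Qed.

Lemma limit_orbit0 : limit_orbit 0 = vec r 0.
Proof.
have := limit_orbit_nat 0 0; rewrite mul0r add0r expr0 scale1r arc0; apply.
by rewrite lexx ltW.
Qed.

(** The output vanishes only at multiples of [tau], so a smaller period could only be [tau], which
    negates the nonzero initial state. *)
Lemma limit_orbit_least_period : least_period limit_orbit (2 * tau).
Proof.
have P0 := limit_orbit0.
split; first by rewrite mulr_gt0.
  move=> u; have -> : u + 2 * tau = u + tau + tau by ring.
  by rewrite !limit_orbitD opprK.
move=> T T0 perT; rewrite leNgt; apply/negP => T2.
have E := perT 0; rewrite add0r in E.
have [n [s [TE st]]] := nat_tau_split T (ltW T0).
have n2 : (n < 2)%N.
  rewrite -(@ltr_nat R) -(ltr_pM2r tau0); move: st => /andP[s0 _]; lra.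
have := limit_orbit_output n s st; rewrite -TE.
rewrite /relay_output E P0 plantC_mul mxE /= sgr0 oppr0; case: eqP => [s0 _|_ /eqP]; last first.
  by rewrite eq_sym oppr_eq0 signr_eq0.
case: n n2 TE => [|[|//]] _ TE; first by move: T0; rewrite TE s0 mul0r addr0 ltxx.
move: E; rewrite TE s0 mul1r addr0 -[tau]add0r limit_orbitD P0 => /matrixP/(_ 0 0).
by rewrite !mxE /=; have := limit_cycle_abscissa_gt0; lra.
Qed.

Lemma limit_orbit_limit_cycle : limit_cycle A B C limit_orbit (2 * tau).
Proof.
split; [exact: limit_orbit_trajectory|exact: limit_orbit_least_period|].
exists 0, (0 + tau); rewrite limit_orbitD limit_orbit0; apply/eqP => /matrixP/(_ 0 0).
by rewrite !mxE /=; have := limit_cycle_abscissa_gt0; lra.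
Qed.

Lemma limit_orbit_symmetric : symmetric_locus (range limit_orbit).
Proof. by move=> _ [s _ <-]; exists (s + tau) => //; rewrite limit_orbitD. Qed.

(** The period is read from the middle of an arc, so that both switchings are interior to it. *)
Lemma limit_orbit_unimodal : unimodal C limit_orbit (2 * tau).
Proof.
have h2 : 0 <= tau / 2 < tau by apply/andP; split; move: tau0; lra.
have hN0 : (tau / 2 == 0) = false by rewrite gt_eqF // divr_gt0.
have out n : relay_output C limit_orbit (n%:R * tau + tau / 2) = - (-1) ^+ n.
  by rewrite limit_orbit_output // hN0.
exists (tau / 2); split.
  by have := out 0%N; rewrite mul0r add0r => ->; rewrite oppr_eq0 signr_eq0.
split.
  exists (fun i : nat => i%:R * tau + tau / 2); split.
  - by rewrite mul0r add0r.
  - by rewrite addrC.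
  move=> i _; split; first by rewrite ltrD2r ltr_pM2r // ltr_nat.
  by rewrite !out mulrNN exprS mulN1r mulrN -expr2 sqrr_sign oppr_lt0.
move=> [t [t0 t3 Ht]].
have mono i : (i <= 3)%N -> tau / 2 <= t i.
  elim: i => // i IH i3; have [tt _] := Ht i i3.
  by apply: le_trans (ltW tt); apply: IH; exact: ltnW.
have ge0 i : (i <= 3)%N -> 0 <= t i.
  by move=> /mono; apply: le_trans; case/andP: h2.
(* A sign change forces a strictly later arc; three of them would lead to time [3 * tau] or beyond,
   outside the window ending at [5 * tau / 2]. *)
have inc (i : nat) (k k' : nat) s s' : (i < 3)%N -> t i = k%:R * tau + s -> 0 <= s < tau ->
    t i.+1 = k'%:R * tau + s' -> 0 <= s' < tau -> (k < k')%N.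
  move=> i3 E st E' st'; have [tt neg] := Ht i i3.
  rewrite ltn_neqAle; apply/andP; split.
    apply/eqP => kk; move: neg; rewrite E E' !limit_orbit_output // -kk.
    case: ifP => _; case: ifP => _; rewrite ?mul0r ?mulr0 ?ltxx //.
    by rewrite mulrNN -expr2 sqrr_sign ltNge ler01.
  rewrite leqNgt; apply/negP => k'k.
  have : (k'.+1)%:R * tau <= k%:R * tau by rewrite ler_pM2r // ler_nat.
  rewrite -natr1 mulrDl mul1r; move: st st' => /andP[? ?] /andP[? ?]; lra.
have [k0 [s0 [E0 S0]]] := nat_tau_split (t 0%N) (ge0 0%N isT).
have [k1 [s1 [E1 S1]]] := nat_tau_split (t 1%N) (ge0 1%N isT).
have [k2 [s2 [E2 S2]]] := nat_tau_split (t 2%N) (ge0 2%N isT).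
have [k3 [s3 [E3 S3]]] := nat_tau_split (t 3%N) (ge0 3%N isT).
have i0 := inc 0%N k0 k1 s0 s1 isT E0 S0 E1 S1.
have i1 := inc 1%N k1 k2 s1 s2 isT E1 S1 E2 S2.
have i2 := inc 2%N k2 k3 s2 s3 isT E2 S2 E3 S3.
have k3_ge : (3 <= k3)%N.
  by apply: leq_trans i2; rewrite ltnS; apply: leq_trans i1; rewrite ltnS (leq_trans _ i0).
have : 3 * tau <= k3%:R * tau by rewrite ler_pM2r // ler_nat.
move: S3 t3 h2 => /andP[s30 _]; rewrite E3; lra.
Qed.

Lemma limit_orbit_attractive : weakly_globally_attractive A B C (range limit_orbit).
Proof.
move=> x0.
have sgn2 (m : nat) : (-1) ^+ m * (-1) ^+ m = 1 :> R by rewrite -expr2 sqrr_sign.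
(* Up to reflection every state is admissible; a point of the line with abscissa at most [- kappa]
   is reflected to a positive one. *)
have [m adm] : exists m : nat,
    admissible (((-1) ^+ m *: x0) 0 0, ((-1) ^+ m *: x0) 1 0).
  rewrite /admissible /=; have [y0|y0|y0] := ltgtP 0 (x0 1 0).
  - by exists 0%N; left; rewrite expr0 scale1r.
  - by exists 1%N; left; rewrite expr1 scaleN1r mxE oppr_gt0.
  have [k|k] := ltP (- kappa) (x0 0 0).
    by exists 0%N; right; rewrite expr0 scale1r; split => //; lra.
  exists 1%N; right; rewrite expr1 scaleN1r !mxE -y0 oppr0; split => //.
  by move: kappa_gt0; lra.
have [z [sig [z0E sig0 Hw zS Hz]]] := orbit_exists _ adm.
pose t n : R := \sum_(i < n) sig i.
have t0 : t 0%N = 0 by rewrite /t big_ord0.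
have tS n : t n.+1 = t n + sig n by rewrite /t big_ord_recr.
have t_le n k : (n <= k)%N -> t n <= t k.
  elim: k => [|k IH]; first by rewrite leqn0 => /eqP ->.
  rewrite leq_eqVlt => /predU1P[->//|]; rewrite ltnS => /IH h.
  by rewrite tS (le_trans h) // lerDl ltW.
(* After the first arc every launch speed is at least [2 * kappa], so every duration is at least
   [dl] and switchings cannot accumulate. *)
have [dl dl0 [Pdl dlE]] := launch_surj _ _ _ _ a_gt0 b_gt0 fs (2 * kappa / gamma)
  (divr_gt0 (mulr_gt0 (ltr0n _ 2) kappa_gt0) gamma_gt0).
have dl_le n : dl <= sig n.+1.
  have [_ h1 P h2 _] := Hz n.
  rewrite -(launch_lt_inv _ _ _ _ a_gt0 b_gt0 fs) // dlE ler_pdivrMr // [_ * gamma]mulrC -h2; lra.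
have tub M : exists n, M < t n.
  have H n : n%:R * dl <= t n.+1.
    elim: n => [|n IH]; first by rewrite mul0r tS t0 add0r ltW.
    by rewrite -natr1 mulrDl mul1r tS lerD.
  pose n := (Num.truncn (`|M| / dl)).+1; exists n.+1; apply: lt_le_trans (H _).
  rewrite -ltr_pdivrMr //; apply: le_lt_trans (truncnS_gt _).
  by rewrite ler_pM2r ?invr_gt0 // ler_norm.
have match_ends n : (-1) ^+ (n + m) *: arc (z n) (sig n) =
    (-1) ^+ (n.+1 + m) *: arc (z n.+1) 0.
  by rewrite zS arc0 addSn exprS mulN1r scaleNr scalerN.
have [x xE] := concatenation _ (fun n s => (-1) ^+ (n + m) *: arc (z n) s) sig t
  t0 tS sig0 tub match_ends.
exists x; split.
- exact: (orbit_trajectory x z sig t m).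
- have := xE 0%N 0; rewrite t0 addr0 => ->; last by rewrite lexx ltW.
  by rewrite arc0 z0E -vec_eta scalerA sgn2 scale1r.
(* The index is shifted because the first arc may start off the switching line, where the recurrence
   does not apply. *)
have csig : sig n.+1 @[n --> \oo] --> tau.
  apply: (launch_landing_cvg _ _ _ _ a_gt0 b_gt0 fs _ _ (fun n => sig n.+1) tau0 Ptau tauE).
    by move=> n; have [_ _ P _ _] := Hz n.
  move=> n; have [_ _ _ _ h1] := Hz n; have [_ _ _ h2 _] := Hz n.+1.
  apply: (mulfI (lt0r_neq0 gamma_gt0)); rewrite -h2 h1.
  by field; rewrite gt_eqF.
have cz : (z n.+1).1 @[n --> \oo] --> r.
  have zE : (fun n => (z n.+1).1) = (fun n => gamma * launch (sig n.+1) - kappa).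
    by apply/funext => n; have [_ _ _ <- _] := Hz n; rewrite addrK.
  rewrite zE; apply: cvgB; last exact: cvg_cst.
  apply: cvgMr; apply: (cvg_comp (fun n => sig n.+1) launch); first exact: csig.
  exact: (launch_continuous _ _ _ _ b_gt0 fs).
have [K HK] := arc_initial_lipschitz.
have [L HL] := arc_lipschitz (r, 0).
have near_le e : 0 < e -> \forall s \near +oo, (edist_inf (range limit_orbit) (x s) <= e%:E)%E.
  move=> e0.
  have K1 : 0 < `|K| + 1 by rewrite ltr_wpDl.
  have L1 : 0 < `|L| + 1 by rewrite ltr_wpDl.
  have /cvgrPdist_lt/(_ (e / 2 / (`|K| + 1))) := cz.
  case; first by rewrite !divr_gt0.
  move=> N1 _ H1.
  have /cvgrPdist_lt/(_ (e / 2 / (`|L| + 1))) := csig.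
  case; first by rewrite !divr_gt0.
  move=> N2 _ H2.
  near=> s.
  have sN : t (maxn N1 N2).+1 <= s by near: s; apply: nbhs_pinfty_ge; exact: num_real.
  have ex : exists n, s < t n.+1.
    by have [n sn] := tub s; exists n; rewrite tS ltr_wpDr // ltW.
  case: (ex_minnP ex) => n sn minn.
  have nN : (maxn N1 N2 < n)%N.
    by rewrite -ltnS ltnNge; apply/negP => /t_le; rewrite leNgt (le_lt_trans sN sn).
  have tns : t n <= s.
    case: n minn nN {sn} => // n minn _; rewrite leNgt; apply/negP => /minn.
    by rewrite ltnn.
  case: n sn minn nN tns => // n sn _; rewrite ltnS geq_max => /andP[N1n N2n] tns.
  have h1 := H1 n N1n; have h2 := H2 n N2n; rewrite /= in h1 h2.
  pose u := s - t n.+1.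
  have u0 : 0 <= u by rewrite subr_ge0.
  have us : u <= sig n.+1 by rewrite lerBlDl -tS ltW.
  (* The comparison point on the cycle. Time is capped at [tau] since the current arc may outlast
     the limit arc; the error splits into a part from the initial abscissa and a part from the
     excess duration, each at most [e / 2]. *)
  pose y := (-1) ^+ (n.+1 + m) *: arc (r, 0) (Num.min u tau).
  have Gy : range limit_orbit y.
    by apply: limit_orbit_arc; rewrite le_min u0 (ltW tau0) ge_min lexx orbT.
  apply: le_trans (edist_inf_triangle _ _ y) _.
  rewrite edist_inf0 // adde0; apply: edist_fin => //=.
  rewrite -ball_normE /=.
  have -> : x s = (-1) ^+ (n.+1 + m) *: arc (z n.+1) u.
    by rewrite -xE ?u0 // /u addrC subrK.
  rewrite -scalerBr normrZ normrX normrN1 expr1n mul1r.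
  have -> : arc (z n.+1) u - arc (r, 0) (Num.min u tau) =
    (arc (z n.+1) u - arc (r, 0) u) + (arc (r, 0) u - arc (r, 0) (Num.min u tau)).
    by rewrite addrA subrK.
  apply: le_lt_trans (ler_normD _ _) _; rewrite (splitr e) ltr_leD //.
    have [z2 _ _ _ _] := Hz n.
    have -> : z n.+1 = ((z n.+1).1, 0) by rewrite -z2; case: (z n.+1).
    apply: le_lt_trans (HK _ _ _ u0) _.
    rewrite distrC in h1; rewrite ltr_pdivlMr // mulrC in h1.
    apply: le_lt_trans h1; by rewrite ler_wpM2r // (le_trans (ler_norm K)) // lerDl ler01.
  have [ut|tu] := leP u tau; first by rewrite subrr normr0 divr_ge0 // ltW.
  apply: le_trans (HL _ _ (ltW tau0) (ltW tu)) _.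
  rewrite ltr_pdivlMr // mulrC in h2; apply: ltW; apply: le_lt_trans h2.
  rewrite distrC; have h3 : u - tau <= `|sig n.+1 - tau|.
    by apply: le_trans (ler_norm _); rewrite lerD2r.
  apply: le_trans (_ : (`|L| + 1) * (u - tau) <= _).
    by rewrite ler_wpM2r ?subr_ge0 ?(ltW tu) // (le_trans (ler_norm L)) // lerDl ler01.
  by rewrite ler_pM2l.
apply/fine_cvgP; split.
  apply: filterS (near_le 1 ltr01) => s h.
  by rewrite ge0_fin_numE ?edist_inf_ge0 // (le_lt_trans h) ?ltry.
apply/cvgrPdist_le => e e0; apply: filterS (near_le e e0) => s h /=.
rewrite sub0r normrN ger0_norm ?fine_ge0 ?edist_inf_ge0 //.
have f : (edist_inf (range limit_orbit) (x s) \is a fin_num)%E.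
  by rewrite ge0_fin_numE ?edist_inf_ge0 // (le_lt_trans h) ?ltry.
by rewrite -lee_fin fineK.
Unshelve. all: by end_near. Qed.

End limit_cycle.
End relay_arcs.

(** * From the poles to the oscillator coefficients, and conclusion *)

Lemma plantA_vec (R : realType) (p1 p2 : R[i]) (x y : R) :
  plantA p1 p2 *m vec x y =
  vec (- (complex.Re (p1 * p2) * y)) (x - - complex.Re (p1 + p2) * y).
Proof.
apply/matrixP => i j; rewrite !mxE !big_ord_recl big_ord0 !mxE /=.
by case: ifP => _; ring.
Qed.

Lemma stable_trace_gt0 (R : realType) (p1 p2 : R[i]) :
  complex.Re p1 < 0 -> complex.Re p2 < 0 -> 0 < - complex.Re (p1 + p2).
Proof. by case: p1 p2 => [u1 v1] [u2 v2] /=; lra. Qed.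

Lemma stable_det_gt0 (R : realType) (p1 p2 : R[i]) : real_or_conjugate p1 p2 ->
  complex.Re p1 < 0 -> complex.Re p2 < 0 -> 0 < complex.Re (p1 * p2).
Proof.
case: p1 p2 => [u1 v1] [u2 v2] H /= u1_lt0 u2_lt0; case: H => [[/= -> ->]|[-> ->]].
  by rewrite mul0r subr0 nmulr_rgt0.
by rewrite mulrN opprK ltr_pwDl ?nmulr_rgt0 // -expr2 sqr_ge0.
Qed.

Theorem mainTheorem1 (R : realType) (kappa gamma : R) (p1 p2 : R[i])
    (kappa_gt0 : 0 < kappa) (gamma_gt0 : 0 < gamma)
    (p1_stable : complex.Re p1 < 0) (p2_stable : complex.Re p2 < 0)
    (p12 : real_or_conjugate p1 p2) :
  let A := plantA p1 p2 in
  let B := plantB kappa gamma in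
  let C := plantC in
  exists (xc : R -> 'cV[R]_2) (T : R),
    [/\ limit_cycle A B C xc T,
        symmetric_locus (range xc),
        unimodal C xc T &
        weakly_globally_attractive A B C (range xc)].
Proof.
move=> A B C.
pose a := - complex.Re (p1 + p2); pose b := complex.Re (p1 * p2).
have a_gt0 : 0 < a := stable_trace_gt0 R p1 p2 p1_stable p2_stable.
have b_gt0 : 0 < b := stable_det_gt0 R p1 p2 p12 p1_stable p2_stable.
have [phi [psi fs]] := fundamental_solution_exists a b.
have K0 : 0 < 2 * kappa / gamma by rewrite divr_gt0 // mulr_gt0.
(* The fixed duration, at which the jump [2 * kappa / gamma] at a switching exactly restores the
   launch speed. *)
have [tau tau_gt0 [Ptau tauE]] :=
  launch_sub_landing_surj a b phi psi a_gt0 b_gt0 fs _ K0.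
have AE := plantA_vec R p1 p2.
exists (limit_orbit a b kappa gamma phi psi tau), (2 * tau); split.
- exact: limit_orbit_limit_cycle.
- exact: limit_orbit_symmetric.
- exact: limit_orbit_unimodal.
- exact: limit_orbit_attractive.
Qed.
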